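(* Let $K\in\mathcal K^2$, let $A=RB^2$ for some $R>0$ be such that $K\subseteq A$, and let $i,j\in\{1,2\}$. Let $f^*$ be the density with respect to $\nu_1^2$ on $\mathcal L_1^2$ with $f^*(L)\propto|g_{ij}(L)|$. Then $$\mathrm{Var}_{f^*}\Big(\frac{\hat\varphi_{ij}(K\cap E)}{f^*(\pi(E))}\Big)<\mathrm{Var}_{IUR}\big(\hat\varphi_{ij}(K\cap E)\big),$$ where on the left-hand side $E$ is an $f^*$-weighted random line in $\mathbb R^2$ hitting $A$, and on the right-hand side $E$ is an isotropic uniform random (IUR) line in $\mathbb R^2$ hitting $A$.
   Context: $\mathcal K^2$ is the set of convex bodies, that is, compact convex subsets, of $\mathbb R^2$; $B^2$ is the closed unit disc centred at the origin. $\mathcal L^2_1$ is the set of lines through the origin in $\mathbb R^2$ and $\nu_1^2$ its rotation invariant probability measure. $\mathcal E_1^2$ is the set of affine lines in $\mathbb R^2$, $\mathcal B(\mathcal E_1^2)$ its Borel $\sigma$-algebra, and $\mu_1^2$ the motion invariant measure on it normalized by $\mu_1^2(\{E:E\cap B^2\neq\emptyset\})=2$. $\pi(E)\in\mathcal L_1^2$ is the line through the origin parallel to $E$. $V_0(M)=1$ if $M$ is a non-empty convex body and $V_0(\emptyset)=0$. For $u=(u_1,u_2)$ in the unit circle $S^1$ with linear span $[u]$, the symmetric matrix $(g_{ij}([u]))$ is given by $$g_{11}([u])=\tfrac38\big(u_1^2-\tfrac13\big),\quad g_{12}([u])=g_{21}([u])=\tfrac38u_1u_2,\quad g_{22}([u])=\tfrac38\big(u_2^2-\tfrac13\big),$$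 and $\hat\varphi_{ij}(K\cap E):=2R\,g_{ij}(\pi(E))\,V_0(K\cap E)$. For a density $f:\mathcal L_1^2\to[0,\infty)$ with respect to $\nu_1^2$, an $f$-weighted random line $E$ in $\mathbb R^2$ hitting $A$ is a random line with distribution $$P(E\in\mathcal A)=\frac1{2R}\int_{\mathcal A}\mathbf 1(E'\cap A\ne\emptyset)\,f(\pi(E'))\,\mu_1^2(dE'),\qquad\mathcal A\in\mathcal B(\mathcal E_1^2).$$ An IUR line hitting $A$ is an $f$-weighted random line hitting $A$ with $f\equiv1$. $\mathrm{Var}_{f}$ and $\mathrm{Var}_{IUR}$ denote the variance when $E$ is an $f$-weighted random line, respectively an IUR line, hitting $A$.
   Formalization: The convex body K is assumed to contain at least two distinct points; for K empty or a single point almost no line hits K, both variances are 0, and the strict inequality fails. *)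

(* Defs.v *)
From HB Require Import structures.
From mathcomp Require Import all_boot all_order all_algebra.
From mathcomp Require Import all_classical all_reals all_analysis.

Set Implicit Arguments.
Unset Strict Implicit.
Unset Printing Implicit Defensive.

Import Order.TTheory GRing.Theory Num.Theory.
Import numFieldNormedType.Exports.
Local Open Scope classical_set_scope.
Local Open Scope ring_scope.

(* The Euclidean plane is 'rV[R]_2. Its library norm is the max norm, so the
   Euclidean structure is introduced through the inner product. *)
Definition dot (R : realType) (u v : 'rV[R]_2) : R := (u *m v^T) 0 0.

Definition disc (R : realType) (r : R) : set 'rV[R]_2 :=
  [set x | Num.sqrt (dot x x) <= r].

Definition convex_body (R : realType) (K : set 'rV[R]_2) : Prop :=
  compact K /\ convex_set K.

Definition V0 (R : realType) (M : set 'rV[R]_2) : R := (`[< M !=set0 >])%:R.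

(* {x + t v : t in R}; used with v != 0 *)
Definition line_through (R : realType) (x v : 'rV[R]_2) : set 'rV[R]_2 :=
  [set x + t *: v | t in [set: R]].

Definition is_linear_line (R : realType) (L : set 'rV[R]_2) : Prop :=
  exists2 v, v != 0 & L = line_through 0 v.

Definition is_affine_line (R : realType) (E : set 'rV[R]_2) : Prop :=
  exists x, exists2 v, v != 0 & E = line_through x v.

(* L_1^2 *)
Record linear_line (R : realType) := LinearLine {
  linear_line_set :> set 'rV[R]_2 ;
  linear_lineP : is_linear_line linear_line_set }.

(* E_1^2 *)
Record affine_line (R : realType) := AffineLine {
  affine_line_set :> set 'rV[R]_2 ;
  affine_lineP : is_affine_line affine_line_set }.

Lemma linear_line_inj (R : realType) (L L' : linear_line R) :
  L = L' :> set _ -> L = L'.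
Proof.
by case: L L' => [A p] [B q] /= AB; subst B; rewrite (Prop_irrelevance p q).
Qed.

Lemma affine_line_inj (R : realType) (E E' : affine_line R) :
  E = E' :> set _ -> E = E'.
Proof.
by case: E E' => [A p] [B q] /= AB; subst B; rewrite (Prop_irrelevance p q).
Qed.

Lemma const_mx1_neq0 (R : realType) : const_mx 1 != 0 :> 'rV[R]_2.
Proof. by apply/eqP => /rowP/(_ 0)/eqP; rewrite !mxE oner_eq0. Qed.

Definition diagonal_linear (R : realType) : linear_line R :=
  LinearLine (ex_intro2 _ _ (const_mx 1) (const_mx1_neq0 R) erefl).

Definition diagonal_affine (R : realType) : affine_line R :=
  AffineLine (ex_intro _ 0
    (ex_intro2 _ _ (const_mx 1) (const_mx1_neq0 R) erefl)).

HB.instance Definition _ (R : realType) := gen_eqMixin (linear_line R).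
HB.instance Definition _ (R : realType) := gen_choiceMixin (linear_line R).
HB.instance Definition _ (R : realType) :=
  isPointed.Build (linear_line R) (diagonal_linear R).
HB.instance Definition _ (R : realType) := gen_eqMixin (affine_line R).
HB.instance Definition _ (R : realType) := gen_choiceMixin (affine_line R).
HB.instance Definition _ (R : realType) :=
  isPointed.Build (affine_line R) (diagonal_affine R).

(* L_1^2 carries the quotient topology of v |-> R v (v != 0). *)
Definition linear_line_open (R : realType) (U : set (linear_line R)) : Prop :=
  open [set v : 'rV[R]_2 | v != 0 /\
    exists2 L : linear_line R, U L & L = line_through 0 v :> set _].

(* E_1^2 carries the quotient topology of (x, v) |-> x + R v (v != 0). *)
Definition affine_line_open (R : realType) (U : set (affine_line R)) : Prop :=
  open [set z : 'rV[R]_2 * 'rV[R]_2 | z.2 != 0 /\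
    exists2 E : affine_line R, U E & E = line_through z.1 z.2 :> set _].

Lemma open_vector_neq0 (R : realType) : open [set v : 'rV[R]_2 | v != 0].
Proof.
have -> : [set v : 'rV[R]_2 | v != 0] = ~` [set 0].
  by apply/seteqP; split=> v /= /eqP.
by apply: closed_openC; exact/accessible_closed_set1/hausdorff_accessible/norm_hausdorff.
Qed.

Lemma linear_line_openT (R : realType) : @linear_line_open R setT.
Proof.
rewrite /linear_line_open [X in open X](_ : _ = [set v | v != 0]).
  exact: open_vector_neq0.
apply/seteqP; split=> v /=; first by case.
by move=> v0; split=> //; exists (LinearLine (ex_intro2 _ _ v v0 erefl)).
Qed.

Lemma linear_line_openI (R : realType) : setI_closed (@linear_line_open R).
Proof.
move=> A B oA oB; have := openI oA oB; rewrite /linear_line_open.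
rewrite [X in open X -> _](_ : _ = [set v | v != 0 /\ exists2 L : linear_line R,
  (A `&` B) L & L = line_through 0 v :> set _]) //.
apply/seteqP; split=> v /=.
  case=> -[v0 [L AL Lv]] [_ [L' BL' L'v]]; split=> //; exists L => //; split=> //.
  by rewrite (@linear_line_inj _ L L')// Lv.
by case=> v0 [L [AL BL] Lv]; split; split=> //; exists L.
Qed.

Lemma linear_line_open_bigU (R : realType) (I : Type)
    (F : I -> set (linear_line R)) :
  (forall i, linear_line_open (F i)) -> linear_line_open (\bigcup_i F i).
Proof.
move=> oF; have := bigcup_open (fun i (_ : setT i) => oF i).
rewrite /linear_line_open [X in open X -> _](_ : _ = [set v | v != 0 /\
  exists2 L, (\bigcup_i F i) L & L = line_through 0 v :> set _]) //.
apply/seteqP; split=> v /=.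
  by case=> i _ [v0 [L FL Lv]]; split=> //; exists L => //; exists i.
by case=> v0 [L [i _ FL] Lv]; exists i => //; split=> //; exists L.
Qed.

HB.instance Definition _ (R : realType) :=
  isOpenTopological.Build (linear_line R) (@linear_line_openT R)
    (@linear_line_openI R) (@linear_line_open_bigU R).

Lemma affine_line_openT (R : realType) : @affine_line_open R setT.
Proof.
rewrite /affine_line_open
  [X in open X](_ : _ = snd @^-1` [set v : 'rV[R]_2 | v != 0]).
  apply: open_comp (@open_vector_neq0 R) => z _; exact: cvg_snd.
apply/seteqP; split=> -[x v] /=; first by case.
move=> v0; split=> //.
by exists (AffineLine (ex_intro _ x (ex_intro2 _ _ v v0 erefl))).
Qed.

Lemma affine_line_openI (R : realType) : setI_closed (@affine_line_open R).
Proof.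
move=> A B oA oB; have := openI oA oB; rewrite /affine_line_open.
rewrite [X in open X -> _](_ : _ = [set z | z.2 != 0 /\
  exists2 E : affine_line R,
    (A `&` B) E & E = line_through z.1 z.2 :> set _]) //.
apply/seteqP; split=> z /=.
  case=> -[v0 [L AL Lv]] [_ [L' BL' L'v]]; split=> //; exists L => //; split=> //.
  by rewrite (@affine_line_inj _ L L')// Lv.
by case=> v0 [L [AL BL] Lv]; split; split=> //; exists L.
Qed.

Lemma affine_line_open_bigU (R : realType) (I : Type)
    (F : I -> set (affine_line R)) :
  (forall i, affine_line_open (F i)) -> affine_line_open (\bigcup_i F i).
Proof.
move=> oF; have := bigcup_open (fun i (_ : setT i) => oF i).
rewrite /affine_line_open [X in open X -> _](_ : _ = [set z | z.2 != 0 /\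
  exists2 E : affine_line R,
    (\bigcup_i F i) E & E = line_through z.1 z.2 :> set _]) //.
apply/seteqP; split=> z /=.
  by case=> i _ [v0 [L FL Lv]]; split=> //; exists L => //; exists i.
by case=> v0 [L [i _ FL] Lv]; exists i => //; split=> //; exists L.
Qed.

HB.instance Definition _ (R : realType) :=
  isOpenTopological.Build (affine_line R) (@affine_line_openT R)
    (@affine_line_openI R) (@affine_line_open_bigU R).

HB.instance Definition _ (R : realType) :=
  @isMeasurable.Build (sigma_display (@open (linear_line R))) (linear_line R)
    <<s @open (linear_line R) >> (@sigma_algebra0 _ setT _)
    (@sigma_algebraC _ _) (@sigma_algebra_bigcup _ setT _).

HB.instance Definition _ (R : realType) :=
  @isMeasurable.Build (sigma_display (@open (affine_line R))) (affine_line R)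
    <<s @open (affine_line R) >> (@sigma_algebra0 _ setT _)
    (@sigma_algebraC _ _) (@sigma_algebra_bigcup _ setT _).

(* pi(E) is the difference set E - E *)
Lemma direction_subproof (R : realType) (E : affine_line R) :
  is_linear_line [set x - y | x in E & y in E].
Proof.
have [a [v v0 ->]] := affine_lineP E; exists v => //=.
apply/seteqP; split=> w /=.
  move=> [_ [s _ <-] [_ [t _ <-] <-]]; exists (s - t) => //.
  by rewrite add0r opprD addrACA subrr add0r scalerBl.
move=> [t _ <-]; exists (a + t *: v); first by exists t.
by exists a; [exists 0 => //; rewrite scale0r addr0|rewrite addrAC subrr].
Qed.

Definition direction (R : realType) (E : affine_line R) : linear_line R :=
  LinearLine (direction_subproof E).

Definition is_rotation (R : realType) (Q : 'M[R]_2) : Prop :=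
  Q *m Q^T = 1%:M /\ \det Q = 1.

Definition rotation_invariant (R : realType)
    (nu : {measure set (linear_line R) -> \bar R}) : Prop :=
  forall Q, is_rotation Q -> forall A, measurable A ->
    nu [set L' : linear_line R | exists2 L : linear_line R,
          A L & L' = [set x *m Q | x in L] :> set _] = nu A.

Definition motion_invariant (R : realType)
    (mu : {measure set (affine_line R) -> \bar R}) : Prop :=
  forall Q (a : 'rV[R]_2), is_rotation Q -> forall A, measurable A ->
    mu [set E' : affine_line R | exists2 E : affine_line R,
          A E & E' = [set x *m Q + a | x in E] :> set _] = mu A.

Definition hitting (R : realType) (A : set 'rV[R]_2) : set (affine_line R) :=
  [set E : affine_line R | (E `&` A) !=set0].

(* a unit vector spanning L; [line_weightE] shows that the choice between
   u and -u is irrelevant *)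
Definition unit_vector (R : realType) (L : linear_line R) : 'rV[R]_2 :=
  xget 0 [set u | dot u u = 1 /\ L = line_through 0 u :> set _].

(* g_ij(L); i, j in {1, 2} are encoded by 'I_2 = {0, 1} *)
Definition line_weight (R : realType) (i j : 'I_2) (L : linear_line R) : R :=
  let u := unit_vector L in
  3 / 8 * (u 0 i * u 0 j - if i == j then 1 / 3 else 0).

Lemma dot_line_through_eq (R : realType) (u v : 'rV[R]_2) :
  dot u u = 1 -> dot v v = 1 -> line_through 0 u = line_through 0 v ->
  u = v \/ u = - v.
Proof.
move=> uu vv uv; have : line_through 0 u u by exists 1; rewrite ?scale1r ?add0r.
rewrite uv => -[t _]; rewrite add0r => tv.
have : t ^+ 2 = 1.
  by move: uu; rewrite -tv /dot linearZ/= -scalemxAl -scalemxAr 2!mxE -/(dot v v)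
    vv mulr1 expr2.
move/eqP; rewrite sqrf_eq1 => /orP[]/eqP t1; rewrite -tv t1.
  by left; rewrite scale1r.
by right; rewrite scaleN1r.
Qed.

Lemma line_weightE (R : realType) (i j : 'I_2) (L : linear_line R)
    (u : 'rV[R]_2) : dot u u = 1 -> L = line_through 0 u :> set _ ->
  line_weight i j L = 3 / 8 * (u 0 i * u 0 j - if i == j then 1 / 3 else 0).
Proof.
move=> uu Lu; rewrite /line_weight /unit_vector; case: xgetP => [v _ [vv Lv]|].
  by case: (dot_line_through_eq uu vv); rewrite -?Lu// => ->; rewrite ?mxE ?mulrNN.
by move=> /(_ u)[].
Qed.

Definition phi_hat (R : realType) (r : R) (i j : 'I_2) (K : set 'rV[R]_2)
    (E : affine_line R) : R :=
  2 * r * line_weight i j (direction E) * V0 (K `&` E).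

Definition is_density (R : realType)
    (nu : {measure set (linear_line R) -> \bar R})
    (f : linear_line R -> R) : Prop :=
  [/\ measurable_fun setT f, (forall L, 0 <= f L) &
      (\int[nu]_L (f L)%:E = 1)%E].

(* E is an f-weighted random line hitting the disc of radius r *)
Definition weighted_random_line (R : realType)
    (mu : {measure set (affine_line R) -> \bar R}) (r : R)
    (f : linear_line R -> R) (d : measure_display) (T : measurableType d)
    (P : probability T R) (E : T -> affine_line R) : Prop :=
  measurable_fun setT E /\
  forall A : set (affine_line R), measurable A ->
    (P (E @^-1` A) = ((2 * r)^-1)%:E *
      \int[mu]_(E' in A)
        (\1_(hitting (disc r)) E' * f (direction E'))%:E)%E.

Definition IUR_line (R : realType)
    (mu : {measure set (affine_line R) -> \bar R}) (r : R)
    (d : measure_display) (T : measurableType d)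
    (P : probability T R) (E : T -> affine_line R) : Prop :=
  weighted_random_line mu r (cst 1) P E.

(* Main.v *)
(* Let g be the weight of a direction and m the integral of |g|. As f* = |g| / m,
   the two estimators have the same mean, and the claim becomes
   m E[|g| 1_K] < E[g^2 1_K], where E is the expectation for an IUR line and 1_K
   indicates that it hits K. By Fubini over translations along the coordinate axes,
   1_K may be replaced by W / (2r), where W is the width of K orthogonal to the line.
   Up to scaling, g = z + kappa with z the cosine of twice the angle of the line
   (up to a phase) and kappa = 0 or 1/3. The only properties of W used are W >= 0,
   W <> 0 and W(t + s) + W(t - s) >= 2 cos(s) W(t), that is W'' + W >= 0 weakly, so
   that the integral of (psi + psi'') W is nonnegative for every psi >= 0.
   Let p = sum_k a_k T_k(z) be a Chebyshev expansion dominating |z + kappa| on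
   [-1, 1]. The integral of p is a_0, so it suffices that (z + kappa)^2 - a_0 p is
   psi + psi'' for some psi > 0; since T_k(z) = cos(2kt) (up to a phase), psi is
   obtained by dividing the k-th coefficient by 1 - 4k^2. Explicit p of degree 10
   (kappa = 1/3) and degree 4 (kappa = 0) do this. *)
Require Import Defs.
From HB Require Import structures.
From mathcomp Require Import all_boot all_order all_algebra.
From mathcomp Require Import all_classical all_reals all_analysis.
From mathcomp Require Import measurable_realfun.
From mathcomp Require Import ring lra.

Import Order.TTheory GRing.Theory Num.Theory.
Import numFieldNormedType.Exports.
Local Open Scope classical_set_scope.
Local Open Scope ring_scope.

Set Implicit Arguments.
Unset Strict Implicit.
Unset Printing Implicit Defensive.


(** * Chebyshev polynomials and polynomial majorants *)

(** A pointwise comparison cannot work: g^2 < m |g| wherever 0 < |g| < m, so the inequality would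
    fail for a weight W concentrated there. Convexity of K forbids such concentration, in the form
    W'' + W >= 0. As W need not be smooth and lines carry no angle parameter, this is used as a
    finite difference inequality under the rotations with cosine c and sines s and -s. Polynomials
    T_k(z) are eigenfunctions of the sum of these two rotations, so integrating against them only
    produces the moments of W. Dividing by 1 - c and letting c tend to 1 yields the factor 1 - 4
    k^2. The integral m is taken against [nu], the others against the law of the direction of an IUR
    line; both measures enter through their rotation invariance. A unit vector of a line is chosen
    up to sign, and the choice has no reason to be measurable. Functions of lines are therefore
    expressed by quantities quadratic in that vector, which are continuous in any spanning
    vector. *)

Fixpoint chebpoly (R : pzRingType) (k : nat) (z : R) : R :=
  match k with
  | 0 => 1
  | k'.+1 => if k' is k''.+1 then 2 * z * chebpoly k' z - chebpoly k'' z else z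
  end.

(* With z = cos t and w = sin t these are cos (k t) and sin (k t). *)
Fixpoint chebpoly_sin (R : pzRingType) (k : nat) (z w : R) : R :=
  if k is k'.+1 then z * chebpoly_sin k' z w + w * chebpoly k' z else 0.

Lemma chebpoly0 (R : pzRingType) (z : R) : chebpoly 0 z = 1.
Proof. by []. Qed.

Lemma chebpoly1 (R : pzRingType) (z : R) : chebpoly 1 z = z.
Proof. by []. Qed.

Lemma chebpolySS (R : pzRingType) k (z : R) :
  chebpoly k.+2 z = 2 * z * chebpoly k.+1 z - chebpoly k z.
Proof. by []. Qed.

(** The addition formula for cos (k t + t); the induction replaces w^2 by 1 - z^2. *)
Lemma chebpolyS (R : realFieldType) (k : nat) (z w : R) :
  z ^+ 2 + w ^+ 2 = 1 ->
  chebpoly k.+1 z = z * chebpoly k z - w * chebpoly_sin k z w.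
Proof.
move=> zw; elim: k => [|k IH]; first by rewrite /=; ring.
have w2 : w ^+ 2 = 1 - z ^+ 2 by rewrite -zw; ring.
rewrite chebpolySS /=.
have -> : w * (z * chebpoly_sin k z w + w * chebpoly k z)
  = z * (w * chebpoly_sin k z w) + w ^+ 2 * chebpoly k z by ring.
have -> : w * chebpoly_sin k z w = z * chebpoly k z - chebpoly k.+1 z.
  by rewrite IH; ring.
by rewrite w2 /=; ring.
Qed.

Lemma chebpoly_sqrD (R : realFieldType) (k : nat) (z w : R) :
  z ^+ 2 + w ^+ 2 = 1 -> chebpoly k z ^+ 2 + chebpoly_sin k z w ^+ 2 = 1.
Proof.
move=> zw; elim: k => [|k IH]; first by rewrite /=; ring.
rewrite (chebpolyS _ zw)/=.
transitivity ((z ^+ 2 + w ^+ 2) * (chebpoly k z ^+ 2 + chebpoly_sin k z w ^+ 2)).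
  by ring.
by rewrite zw IH mulr1.
Qed.

Lemma chebpoly_norm_le1 (R : rcfType) (k : nat) (z : R) :
  -1 <= z <= 1 -> `|chebpoly k z| <= 1.
Proof.
move=> /andP[zl zr]; have z2 : 0 <= 1 - z ^+ 2.
  have -> : 1 - z ^+ 2 = (1 - z) * (z - (-1)) by ring.
  by rewrite mulr_ge0 ?subr_ge0.
have zw : z ^+ 2 + Num.sqrt (1 - z ^+ 2) ^+ 2 = 1 by rewrite sqr_sqrtr//; ring.
have := chebpoly_sqrD k zw.
set C := chebpoly k z; set S := chebpoly_sin _ _ _ => CS.
have C1 : C ^+ 2 <= 1 by rewrite -CS lerDl sqr_ge0.
by rewrite ler_norml; apply/andP; split; nra.
Qed.

(** With (z, w) and (c, s) at angles t and u, these are the addition formulas for k (t + u). Cosine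
    and sine are proved together because the induction step mixes them. *)
Lemma chebpoly_rotation_pair (R : realFieldType) (k : nat) (z w c s : R) :
  z ^+ 2 + w ^+ 2 = 1 -> c ^+ 2 + s ^+ 2 = 1 ->
  chebpoly k (c * z - s * w) = chebpoly k c * chebpoly k z
    - chebpoly_sin k c s * chebpoly_sin k z w /\
  chebpoly_sin k (c * z - s * w) (c * w + s * z) =
    chebpoly_sin k c s * chebpoly k z + chebpoly k c * chebpoly_sin k z w.
Proof.
move=> zw cs.
have rot1 : (c * z - s * w) ^+ 2 + (c * w + s * z) ^+ 2 = 1.
  transitivity ((c ^+ 2 + s ^+ 2) * (z ^+ 2 + w ^+ 2)); first by ring.
  by rewrite zw cs mulr1.
elim: k => [|k [IHC IHS]]; first by split; rewrite /=; ring.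
split; first by rewrite (chebpolyS _ rot1) (chebpolyS _ zw) (chebpolyS _ cs)
  IHC IHS /=; ring.
rewrite [LHS]/= IHC IHS (chebpolyS _ zw) (chebpolyS _ cs) /=; ring.
Qed.

(** The sine is odd in u, so the products of sines cancel. Thus cos (k t) is an eigenfunction of the
    sum of the shifts by u and -u, with eigenvalue 2 cos (k u). *)
Lemma chebpoly_rotationD (R : realFieldType) (k : nat) (z w c s : R) :
  z ^+ 2 + w ^+ 2 = 1 -> c ^+ 2 + s ^+ 2 = 1 ->
  chebpoly k (c * z - s * w) + chebpoly k (c * z + s * w) =
  2 * chebpoly k c * chebpoly k z.
Proof.
move=> zw cs; have [-> _] := chebpoly_rotation_pair k zw cs.
have sinN : chebpoly_sin k c (- s) = - chebpoly_sin k c s.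
  by elim: k => [|k IH] /=; rewrite ?oppr0// IH; ring.
have csN : c ^+ 2 + (- s) ^+ 2 = 1 by rewrite sqrrN.
have [] := chebpoly_rotation_pair k zw csN.
by rewrite mulNr opprK sinN => -> _; ring.
Qed.

Arguments chebpoly : simpl never.

(* The expansion of (z + kappa)^2 in Chebyshev polynomials. *)
Definition hcoef (R : fieldType) (kappa : R) (k : nat) : R :=
  nth 0 [:: 1 / 2 + kappa ^+ 2; 2 * kappa; 1 / 2] k.

(* A Chebyshev expansion of a polynomial majorant of |z + 1/3| on [-1, 1]: it
   interpolates at 17/20, 9/20, -2/25, -23/40, -9/10 (doubly) and at 1, with the
   remaining freedom used to satisfy [cert3_width]; the coefficients are rounded. *)
Definition pcoef3 (R : fieldType) (k : nat) : R :=
  nth 0 [:: 67 + 99 / 100; 41 + 33 / 100; 34 + 71 / 100; - 11 - 10 / 100;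
    - 2 - 14 / 100; 4 + 22 / 100; - 1 - 3 / 100; - 1 - 35 / 100;
    1 + 6 / 100; 16 / 100; - (48 / 100)] k / 100.

Lemma chebpolyE (R : comNzRingType) (z : R) :
  (chebpoly 0 z = 1) * (chebpoly 1 z = z) *
  (chebpoly 2 z = 2 * z ^+ 2 - 1) *
  (chebpoly 3 z = 4 * z ^+ 3 - 3 * z) *
  (chebpoly 4 z = 8 * z ^+ 4 - 8 * z ^+ 2 + 1) *
  (chebpoly 5 z = 16 * z ^+ 5 - 20 * z ^+ 3 + 5 * z) *
  (chebpoly 6 z = 32 * z ^+ 6 - 48 * z ^+ 4 + 18 * z ^+ 2 - 1) *
  (chebpoly 7 z = 64 * z ^+ 7 - 112 * z ^+ 5 + 56 * z ^+ 3 - 7 * z) *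
  (chebpoly 8 z = 128 * z ^+ 8 - 256 * z ^+ 6 + 160 * z ^+ 4 - 32 * z ^+ 2 + 1) *
  (chebpoly 9 z = 256 * z ^+ 9 - 576 * z ^+ 7 + 432 * z ^+ 5 - 120 * z ^+ 3
     + 9 * z) *
  (chebpoly 10 z = 512 * z ^+ 10 - 1280 * z ^+ 8 + 1120 * z ^+ 6
     - 400 * z ^+ 4 + 50 * z ^+ 2 - 1).
Proof. by do !split; rewrite ?chebpolySS chebpoly0 ?chebpoly1; ring. Qed.

(** A nonnegative combination of these products is nonnegative on [-1, 1]; given the instances with
    i + j fixed, [lra] finds the coefficients. *)
Lemma bernstein_ge0 (R : realFieldType) (z : R) (i j : nat) : -1 <= z <= 1 ->
  0 <= (1 + z) ^+ i * (1 - z) ^+ j.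
Proof.
by move=> /andP[zl zr]; rewrite mulr_ge0 ?exprn_ge0 ?subr_ge0//; lra.
Qed.

(** Up to rounding, p - (z + 1/3) is the polynomial in [p0]: double zeros at 17/20, 9/20 and -2/25,
    a simple zero at 1, and a cubic cofactor that is nonnegative on [-1, 1]. The bounds -1 <= T_k <=
    1 absorb the rounding errors of the coefficients. *)
Lemma cert3_upper_right (R : rcfType) (z : R) : -1 <= z <= 1 ->
  z + 1 / 3 <= \sum_(k < 11) pcoef3 R k * chebpoly k z.
Proof.
move=> z1; have /andP[zl zr] := z1.
have b k : -1 <= chebpoly k z <= 1.
  by rewrite -ler_norml; exact: chebpoly_norm_le1.
have [b1 b2 b3 b4 b5] := And5 (b 1) (b 2) (b 3) (b 4) (b 5).
have [b6 b7 b8 b9 b10] := And5 (b 6) (b 7) (b 8) (b 9) (b 10).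
have q0 : 0 <= (361 + 28 / 100) / 100 + (904 + 80 / 100) / 100 * z + 799 / 100 * z ^+ 2
    + (244 + 52 / 100) / 100 * z ^+ 3.
  have B i j := bernstein_ge0 i j z1.
  by have [] := And4 (B 3 0) (B 2 1) (B 1 2) (B 0 3); clear; lra.
have p0 : 0 <= ((z - 17 / 20) * (z - 9 / 20) * (z + 2 / 25)) ^+ 2 * (1 - z)
    * ((361 + 28 / 100) / 100 + (904 + 80 / 100) / 100 * z + 799 / 100 * z ^+ 2 + (244 + 52 / 100) / 100 * z ^+ 3).
  by apply: mulr_ge0 q0; apply: mulr_ge0; [exact: sqr_ge0|lra].
clear q0 z1 zl zr b.
rewrite !big_ord_recr big_ord0 /pcoef3 /=.
rewrite !chebpolyE in b1 b2 b3 b4 b5 b6 b7 b8 b9 b10 *.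
lra.
Qed.

(** The double zeros are now -23/40 and -9/10, with a sextic cofactor certified by the products of
    degree 7; the bounds on T_k again absorb the rounding. *)
Lemma cert3_upper_left (R : rcfType) (z : R) : -1 <= z <= 1 ->
  - (z + 1 / 3) <= \sum_(k < 11) pcoef3 R k * chebpoly k z.
Proof.
move=> z1; have /andP[zl zr] := z1.
have b k : -1 <= chebpoly k z <= 1.
  by rewrite -ler_norml; exact: chebpoly_norm_le1.
have [b1 b2 b3 b4 b5] := And5 (b 1) (b 2) (b 3) (b 4) (b 5).
have [b6 b7 b8 b9 b10] := And5 (b 6) (b 7) (b 8) (b 9) (b 10).
have q0 : 0 <= (250 + 20 / 100) / 100 - (654 + 56 / 100) / 100 * z + (769 + 87 / 100) / 100 * z ^+ 2
    - (134 + 43 / 100) / 100 * z ^+ 3 - (720 + 28 / 100) / 100 * z ^+ 4 + (763 + 50 / 100) / 100 * z ^+ 5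
    - (244 + 52 / 100) / 100 * z ^+ 6.
  have B i j := bernstein_ge0 i j z1.
  have [] := And4 (B 7 0) (B 6 1) (B 5 2) (B 4 3).
  by have [] := And4 (B 3 4) (B 2 5) (B 1 6) (B 0 7); clear; lra.
have p0 : 0 <= ((z + 23 / 40) * (z + 9 / 10)) ^+ 2
    * ((250 + 20 / 100) / 100 - (654 + 56 / 100) / 100 * z + (769 + 87 / 100) / 100 * z ^+ 2
    - (134 + 43 / 100) / 100 * z ^+ 3 - (720 + 28 / 100) / 100 * z ^+ 4 + (763 + 50 / 100) / 100 * z ^+ 5
    - (244 + 52 / 100) / 100 * z ^+ 6).
  by apply: mulr_ge0 q0; exact: sqr_ge0.
clear q0 z1 zl zr b.
rewrite !big_ord_recr big_ord0 /pcoef3 /=.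
rewrite !chebpolyE in b1 b2 b3 b4 b5 b6 b7 b8 b9 b10 *.
lra.
Qed.

Lemma cert3_upper (R : rcfType) (z : R) : -1 <= z <= 1 ->
  `|z + 1 / 3| <= \sum_(k < 11) pcoef3 R k * chebpoly k z.
Proof.
move=> z1; rewrite ler_norml lerNl.
by rewrite cert3_upper_left// cert3_upper_right.
Qed.

(** The difference of the two sides is a nonnegative combination of the Bernstein products of degree
    10. The margin 1/10000 is what later makes the integral inequality strict. *)
Lemma cert3_width (R : rcfType) (z : R) : -1 <= z <= 1 ->
  1 / (100 * 100) <= \sum_(k < 11) (hcoef (1 / 3) k - pcoef3 R 0 * pcoef3 R k)
    / (1 - 4 * k%:R ^+ 2) * chebpoly k z.
Proof.
move=> z1; have B i j := bernstein_ge0 i j z1.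
rewrite !big_ord_recr big_ord0 /pcoef3 /hcoef /= !chebpolyE.
rewrite expr0n /= mulr0 subr0.
(* The inverses are evaluated so that [lra] meets rational coefficients. *)
have -> : (1 - 4 * 1 ^+ 2)^-1 = - 3^-1 :> R by field.
have -> : (1 - 4 * 2 ^+ 2)^-1 = - 15^-1 :> R by field.
have -> : (1 - 4 * 3 ^+ 2)^-1 = - 35^-1 :> R by field.
have -> : (1 - 4 * 4 ^+ 2)^-1 = - 63^-1 :> R by field.
have -> : (1 - 4 * 5 ^+ 2)^-1 = - 99^-1 :> R by field.
have -> : (1 - 4 * 6 ^+ 2)^-1 = - 143^-1 :> R by field.
have -> : (1 - 4 * 7 ^+ 2)^-1 = - 195^-1 :> R by field.
have -> : (1 - 4 * 8 ^+ 2)^-1 = - 255^-1 :> R by field.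
have -> : (1 - 4 * 9 ^+ 2)^-1 = - 323^-1 :> R by field.
have -> : (1 - 4 * 10 ^+ 2)^-1 = - 399^-1 :> R by field.
have [] := And5 (B 10%N 0%N) (B 9 1) (B 8 2) (B 7 3) (B 6 4).
have [] := And5 (B 5 5) (B 4 6) (B 3 7) (B 2 8) (B 1 9).
have := B 0 10; clear; lra.
Qed.

(** The expansion of (2 + 11 z^2 - 4 z^4) / 9, the even quartic that is tangent to |z| at 1/2 and
    -1/2 and agrees with it at 1 and -1. *)
Definition pcoef0 (R : fieldType) (k : nat) : R :=
  nth 0 [:: 2 / 3; 0; 7 / 18; 0; - (1 / 18)] k.

Lemma cert0_upper (R : rcfType) (z : R) : -1 <= z <= 1 ->
  `|z + 0| <= \sum_(k < 5) pcoef0 R k * chebpoly k z.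
Proof.
move=> /andP[zl zr].
(* This product is 9/4 times the majorant minus z; its mirror image [zd] is 9/4 times the majorant
   plus z. *)
have zu : 0 <= (z - 1 / 2) ^+ 2 * (1 - z) * (z + 2).
  by apply: mulr_ge0; [apply: mulr_ge0; [exact: sqr_ge0|lra]|lra].
have zd : 0 <= (z + 1 / 2) ^+ 2 * (1 + z) * (2 - z).
  by apply: mulr_ge0; [apply: mulr_ge0; [exact: sqr_ge0|lra]|lra].
rewrite !big_ord_recr big_ord0 /pcoef0 /= !chebpolyE.
by rewrite ler_norml; apply/andP; split; lra.
Qed.

Lemma cert0_width (R : rcfType) (z : R) : -1 <= z <= 1 ->
  1 / (100 * 100) <= \sum_(k < 5) (hcoef 0 k - pcoef0 R 0 * pcoef0 R k)
    / (1 - 4 * k%:R ^+ 2) * chebpoly k z.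
Proof.
move=> z1; have B i j := bernstein_ge0 i j z1.
rewrite !big_ord_recr big_ord0 /pcoef0 /hcoef /= !chebpolyE.
rewrite expr0n /= mulr0 subr0.
have -> : (1 - 4 * 1 ^+ 2)^-1 = - 3^-1 :> R by field.
have -> : (1 - 4 * 2 ^+ 2)^-1 = - 15^-1 :> R by field.
have -> : (1 - 4 * 3 ^+ 2)^-1 = - 35^-1 :> R by field.
have -> : (1 - 4 * 4 ^+ 2)^-1 = - 63^-1 :> R by field.
have [] := And5 (B 4 0) (B 3 1) (B 2 2) (B 1 3) (B 0 4); clear; lra.
Qed.

(** * Integrals of bounded measurable functions *)

(** Stable under sums, products and measurable substitutions, and integrable for every probability,
    so that one predicate serves the side conditions of the integral manipulations. *)
Definition bounded_measurable d (T : measurableType d) (R : realType)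
    (F : T -> R) : Prop :=
  measurable_fun setT F /\ exists M, forall x, `|F x| <= M.

Section bounded_measurable_theory.
Context d (T : measurableType d) (R : realType) (P : probability T R).
Implicit Types F G : T -> R.

Lemma bounded_measurable_cst (a : R) : bounded_measurable (fun _ : T => a).
Proof. by split; [exact: measurable_cst|exists `|a|]. Qed.

Lemma bounded_measurableD F G : bounded_measurable F -> bounded_measurable G ->
  bounded_measurable (fun x => F x + G x).
Proof.
move=> [mF [M FM]] [mG [N GN]]; split; first exact: measurable_funD.
by exists (M + N) => x; rewrite (le_trans (ler_normD _ _))// lerD.
Qed.

Lemma bounded_measurableM F G : bounded_measurable F -> bounded_measurable G ->
  bounded_measurable (fun x => F x * G x).
Proof.
move=> [mF [M FM]] [mG [N GN]]; split; first exact: measurable_funM.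
by exists (M * N) => x; rewrite normrM ler_pM.
Qed.

Lemma bounded_measurableN F : bounded_measurable F ->
  bounded_measurable (fun x => - F x).
Proof.
move=> /(bounded_measurableM (bounded_measurable_cst (-1))).
by congr bounded_measurable; apply/funext => x; rewrite mulN1r.
Qed.

Lemma bounded_measurableB F G : bounded_measurable F -> bounded_measurable G ->
  bounded_measurable (fun x => F x - G x).
Proof. by move=> bF /bounded_measurableN; exact: bounded_measurableD. Qed.

Lemma bounded_measurable_norm F : bounded_measurable F ->
  bounded_measurable (fun x => `|F x|).
Proof.
move=> [mF [M FM]]; split; first exact: measurableT_comp.
by exists M => x; rewrite normr_id.
Qed.

Lemma bounded_measurable_sum n (F : nat -> T -> R) :
  (forall k, bounded_measurable (F k)) ->
  bounded_measurable (fun x => \sum_(k < n) F k x).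
Proof.
move=> bF; elim: n => [|n IH].
  have := bounded_measurable_cst 0; congr bounded_measurable.
  by apply/funext => x; rewrite big_ord0.
have := bounded_measurableD IH (bF n); congr bounded_measurable.
by apply/funext => x; rewrite big_ord_recr.
Qed.

Lemma bounded_measurable_comp d' (T' : measurableType d') (phi : T' -> T) F :
  measurable_fun setT phi -> bounded_measurable F ->
  bounded_measurable (fun x => F (phi x)).
Proof.
by move=> mphi [mF [M FM]]; split; [exact: measurableT_comp|exists M].
Qed.

Lemma bounded_measurable_integrable F : bounded_measurable F ->
  P.-integrable setT (EFin \o F).
Proof.
move=> [mF [M FM]]; apply: measurable_bounded_integrable => //.
  by rewrite -ge0_fin_numE//; exact: fin_num_measure.
by exists M; split; [exact: num_real|move=> x Mx y _ /=; rewrite (le_trans (FM y))// ltW].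
Qed.

Lemma Rintegral_bmD F G : bounded_measurable F -> bounded_measurable G ->
  \int[P]_x (F x + G x) = \int[P]_x F x + \int[P]_x G x.
Proof.
by move=> *; rewrite RintegralD//; exact: bounded_measurable_integrable.
Qed.

Lemma Rintegral_bmB F G : bounded_measurable F -> bounded_measurable G ->
  \int[P]_x (F x - G x) = \int[P]_x F x - \int[P]_x G x.
Proof.
by move=> *; rewrite RintegralB//; exact: bounded_measurable_integrable.
Qed.

Lemma Rintegral_bmZ (a : R) F : bounded_measurable F ->
  \int[P]_x (a * F x) = a * \int[P]_x F x.
Proof.
by move=> *; rewrite RintegralZl//; exact: bounded_measurable_integrable.
Qed.

Lemma Rintegral_bm_sum n (F : nat -> T -> R) :
  (forall k, bounded_measurable (F k)) ->
  \int[P]_x (\sum_(k < n) F k x) = \sum_(k < n) \int[P]_x F k x.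
Proof.
move=> bF; elim: n => [|n IH].
  rewrite big_ord0; under eq_Rintegral do rewrite big_ord0.
  by rewrite Rintegral_cst// mul0r.
rewrite big_ord_recr/= -IH -Rintegral_bmD//; last exact: bounded_measurable_sum.
by apply: eq_Rintegral => x _; rewrite big_ord_recr.
Qed.

Lemma le_Rintegral_bm F G : bounded_measurable F -> bounded_measurable G ->
  (forall x, F x <= G x) -> \int[P]_x F x <= \int[P]_x G x.
Proof.
by move=> *; apply: le_Rintegral => //; exact: bounded_measurable_integrable.
Qed.

Lemma Rintegral_invariant (phi : T -> T) F : measurable_fun setT phi ->
  (forall A, measurable A -> P (phi @^-1` A) = P A) -> bounded_measurable F ->
  \int[P]_x F (phi x) = \int[P]_x F x.
Proof.
move=> mphi Pphi bF; rewrite /Rintegral.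
have mFp : measurable_fun setT (EFin \o F) by apply/measurable_EFinP; case: bF.
have iF : P.-integrable setT ((EFin \o F) \o phi).
  by apply: (bounded_measurable_integrable (bounded_measurable_comp mphi bF)).
congr fine; have := integral_pushforward mphi mFp iF measurableT.
rewrite preimage_setT => <-; apply: eq_measure_integral => A mA _.
exact: Pphi.
Qed.

Lemma Rintegral_probability_cst (c : R) : \int[P]_x c = c.
Proof.
rewrite Rintegral_cst//; transitivity (c * fine 1%E); last by rewrite mulr1.
by congr (_ * fine _); exact: probability_setT.
Qed.

End bounded_measurable_theory.

(** * Chebyshev polynomials near 1 and the limit of small rotations *)

Lemma chebpoly_measurable (R : realType) k :
  measurable_fun setT (@chebpoly R k).
Proof.
suff [] : measurable_fun setT (@chebpoly R k) /\
  measurable_fun setT (@chebpoly R k.+1) by [].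
elim: k => [|k [IH0 IH1]]; first by split; [exact: measurable_cst|exact: measurable_id].
split => //; apply: measurable_funB => //; apply: measurable_funM => //.
Qed.

(* (1 - T_k(c)) / (1 - c); its value k^2 at c = 1 is the derivative T_k'(1). *)
Fixpoint chebpoly_quotient (R : pzRingType) (k : nat) (c : R) : R :=
  match k with
  | 0 => 0
  | k'.+1 => if k' is k''.+1 then
      2 * c * chebpoly_quotient k' c - chebpoly_quotient k'' c + 2 else 1
  end.

Lemma chebpoly_quotientSS (R : pzRingType) k (c : R) : chebpoly_quotient k.+2 c =
  2 * c * chebpoly_quotient k.+1 c - chebpoly_quotient k c + 2.
Proof. by []. Qed.

Lemma chebpoly_quotientE (R : realFieldType) k (c : R) :
  chebpoly k c = 1 - (1 - c) * chebpoly_quotient k c.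
Proof.
suff [] : chebpoly k c = 1 - (1 - c) * chebpoly_quotient k c /\
  chebpoly k.+1 c = 1 - (1 - c) * chebpoly_quotient k.+1 c by [].
elim: k => [|k [IH0 IH1]].
  by rewrite chebpoly0 chebpoly1 /=; split; ring.
split => //; rewrite chebpolySS IH0 IH1 chebpoly_quotientSS; ring.
Qed.

Lemma chebpoly_quotient1 (R : realFieldType) k :
  chebpoly_quotient k (1 : R) = k%:R ^+ 2.
Proof.
suff [] : chebpoly_quotient k (1 : R) = k%:R ^+ 2 /\
  chebpoly_quotient k.+1 (1 : R) = k.+1%:R ^+ 2 by [].
elim: k => [|k [IH0 IH1]]; first by rewrite /= expr0n expr1n.
by split => //; rewrite chebpoly_quotientSS IH0 IH1; ring.
Qed.

Lemma continuous_fun_add (T : topologicalType) (R : realType) (f g : T -> R) x :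
  continuous_at x f -> continuous_at x g ->
  continuous_at x (fun y => f y + g y).
Proof. by move=> cf cg; apply: cvgD; [exact: cf|exact: cg]. Qed.

Lemma continuous_fun_mul (T : topologicalType) (R : realType) (f g : T -> R) x :
  continuous_at x f -> continuous_at x g ->
  continuous_at x (fun y => f y * g y).
Proof. by move=> cf cg; apply: cvgM; [exact: cf|exact: cg]. Qed.

Lemma continuous_fun_sum (T : topologicalType) (R : realType) n
    (F : nat -> T -> R) x : (forall k, continuous_at x (F k)) ->
  continuous_at x (fun y => \sum_(k < n) F k y).
Proof.
move=> cF; elim: n => [|n IH].
  rewrite (_ : (fun y => _) = fun=> 0); first exact: cst_continuous.
  by apply/funext => y; rewrite big_ord0.
rewrite (_ : (fun y => _) = fun y => \sum_(k < n) F k y + F n y).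
  exact: continuous_fun_add.
by apply/funext => y; rewrite big_ord_recr.
Qed.

Lemma chebpoly_quotient_continuous (R : realType) k :
  continuous (@chebpoly_quotient R k).
Proof.
suff [] : continuous (@chebpoly_quotient R k) /\
  continuous (@chebpoly_quotient R k.+1) by [].
elim: k => [|k [IH0 IH1]]; first by split; exact: cst_continuous.
split => // x.
rewrite (_ : chebpoly_quotient k.+2 = fun c : R =>
  2 * c * chebpoly_quotient k.+1 c - chebpoly_quotient k c + 2)//.
apply: (continuous_fun_add (g := fun=> 2)); last exact: cst_continuous.
apply: (continuous_fun_add (g := fun c => - _)); last first.
  by apply: continuousN; exact: IH0.
apply: (@continuous_fun_mul R R (fun y => 2 * y) (chebpoly_quotient k.+1)); last exact: IH1.
by apply: (@continuous_fun_mul R R (fun=> 2) id) => //; exact: cst_continuous.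
Qed.

Lemma continuous_quotient_double (R : realType) k :
  continuous (fun c : R => chebpoly_quotient k (2 * c ^+ 2 - 1)).
Proof.
move=> x; apply: (@continuous_comp R R R (fun c => 2 * c ^+ 2 - 1)); last first.
  exact: chebpoly_quotient_continuous.
apply: (@continuous_fun_add R R _ (fun=> -1)); last exact: cst_continuous.
apply: (@continuous_fun_mul R R (fun=> 2)); first exact: cst_continuous.
exact: exprn_continuous.
Qed.

(** Stands for letting an angle with cosine c tend to 0: inequalities obtained for 0 < c < 1 after
    division by 1 - c pass to c = 1. *)
Lemma continuous_ge0_at1 (R : realType) (G : R -> R) :
  continuous_at (1 : R) G -> (forall c : R, 0 < c < 1 -> 0 <= G c) -> 0 <= G 1.
Proof.
move=> cG G0; rewrite leNgt; apply/negP => G1.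
have : \forall c \near (1 : R), G c < 0 by exact: (cvgr_lt (G 1) cG).
move=> /nbhs_ballP[e /= e0 He].
(* The bound e / 2 places c in the ball where G is negative, the bound 1 / 2 keeps c positive. *)
pose c := 1 - Num.min (e / 2) (1 / 2).
have m0 : 0 < Num.min (e / 2) (1 / 2) by rewrite lt_min; apply/andP; split; lra.
have m1 : Num.min (e / 2) (1 / 2) <= 1 / 2 by rewrite ge_min lexx orbT.
have m2 : Num.min (e / 2) (1 / 2) <= e / 2 by rewrite ge_min lexx.
have : G c < 0.
  by apply: He; rewrite /ball/= /c opprB addrC subrK gtr0_norm//; lra.
by rewrite ltNge G0// /c; apply/andP; split; lra.
Qed.

(* [rho c s] is the rotation by the angle with cosine [c] and sine [s] acting on
   a space of lines, [(Z, Z')] are the cosine and sine of twice the angle of a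
   line and [W] is the width function of a convex body. *)
Section rotation_invariant_trigonometry.
Context d (T : measurableType d) (R : realType).
Variables (rho : R -> R -> T -> T) (Z Z' : T -> R).
Hypothesis mrho : forall c s, c ^+ 2 + s ^+ 2 = 1 ->
  measurable_fun setT (rho c s).
Hypothesis mZ : measurable_fun setT Z.
Hypothesis ZZ' : forall x, Z x ^+ 2 + Z' x ^+ 2 = 1.
Hypothesis Zrho : forall c s x, c ^+ 2 + s ^+ 2 = 1 ->
  Z (rho c s x) = (c ^+ 2 - s ^+ 2) * Z x - 2 * c * s * Z' x.
Hypothesis rhoN : forall c s x, c ^+ 2 + s ^+ 2 = 1 ->
  Z (rho c s (rho c (- s) x)) = Z x.

Definition rho_invariant (P : probability T R) := forall c s,
  c ^+ 2 + s ^+ 2 = 1 -> forall A, measurable A -> P (rho c s @^-1` A) = P A.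

Let Z1 x : -1 <= Z x <= 1.
Proof.
have := ZZ' x; have := sqr_ge0 (Z' x); set z := Z x => a b.
by apply/andP; split; nra.
Qed.

Let bT k : bounded_measurable (fun x => chebpoly k (Z x)).
Proof.
split; first by apply: measurableT_comp mZ; exact: chebpoly_measurable.
by exists 1 => x; exact: chebpoly_norm_le1.
Qed.

Let bmrho c s (F : T -> R) : c ^+ 2 + s ^+ 2 = 1 -> bounded_measurable F ->
  bounded_measurable (fun x => F (rho c s x)).
Proof. by move=> cs; exact/bounded_measurable_comp/mrho. Qed.

Let sqrN c s : c ^+ 2 + s ^+ 2 = 1 :> R -> c ^+ 2 + (- s) ^+ 2 = 1.
Proof. by rewrite sqrrN. Qed.

Let int_cheb_sum (P : probability T R) (V : T -> R) n (a : nat -> R) :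
  bounded_measurable V ->
  \int[P]_x ((\sum_(k < n) a k * chebpoly k (Z x)) * V x) =
  \sum_(k < n) a k * \int[P]_x (chebpoly k (Z x) * V x).
Proof.
move=> bV; under eq_Rintegral do rewrite mulr_suml.
rewrite (@Rintegral_bm_sum _ _ _ P n (fun k x => a k * chebpoly k (Z x) * V x)).
  apply: eq_bigr => k _; rewrite -Rintegral_bmZ; last exact: bounded_measurableM.
  by apply: eq_Rintegral => x _; rewrite mulrA.
move=> k; apply: bounded_measurableM => //; apply: bounded_measurableM => //.
exact: bounded_measurable_cst.
Qed.

Let double c s : c ^+ 2 + s ^+ 2 = 1 :> R ->
  (c ^+ 2 - s ^+ 2) ^+ 2 + (2 * c * s) ^+ 2 = 1.
Proof. by move=> cs; transitivity ((c ^+ 2 + s ^+ 2) ^+ 2); [ring|rewrite cs expr1n]. Qed.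

(** A rotation turns (Z, Z') by twice its angle, so the eigenvalue involves the double angle cosine
    c^2 - s^2. *)
Let chebZ k c s x : c ^+ 2 + s ^+ 2 = 1 ->
  chebpoly k (Z (rho c s x)) + chebpoly k (Z (rho c (- s) x)) =
  2 * chebpoly k (c ^+ 2 - s ^+ 2) * chebpoly k (Z x).
Proof.
move=> cs; rewrite !Zrho ?sqrN// -(chebpoly_rotationD k (ZZ' x) (double cs)).
by congr (chebpoly _ _ + chebpoly _ _); ring.
Qed.

Let sin_of c : 0 < c < 1 -> c ^+ 2 + Num.sqrt (1 - c ^+ 2) ^+ 2 = 1 :> R.
Proof.
move=> /andP[c0 c1]; rewrite sqr_sqrtr; first by ring.
by rewrite subr_ge0; nra.
Qed.

(** Adding the rotations by opposite angles gives 2 T(c^2 - s^2) I = 2 I for the integral I, where T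
    has degree k + 1. Since 1 - (2 c^2 - 1) = 2 (1 - c) (1 + c), the factor 1 - c can be cancelled
    for c < 1; at c = 1 the remaining coefficient is 2 (k + 1)^2, which is not 0. The limit spares
    the choice of an angle depending on k. *)
Lemma Rintegral_chebpoly (P : probability T R) k : rho_invariant P ->
  \int[P]_x chebpoly k.+1 (Z x) = 0.
Proof.
move=> Pinv; set I := \int[P]_x _.
have I0 c : 0 < c < 1 ->
    (1 + c) * chebpoly_quotient k.+1 (2 * c ^+ 2 - 1) * I = 0.
  move=> c01; have cs := sin_of c01; set s := Num.sqrt _ in cs.
  have : 2 * chebpoly k.+1 (c ^+ 2 - s ^+ 2) * I = I + I.
    rewrite -Rintegral_bmZ//; under eq_Rintegral do rewrite -(chebZ _ _ cs).
    have b := bT k.+1.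
    rewrite (Rintegral_bmD P (bmrho cs b) (bmrho (sqrN cs) b)).
    rewrite (Rintegral_invariant (mrho cs) (Pinv _ _ cs) b).
    by rewrite (Rintegral_invariant (mrho (sqrN cs)) (Pinv _ _ (sqrN cs)) b).
  have -> : c ^+ 2 - s ^+ 2 = 2 * c ^+ 2 - 1 by lra.
  rewrite chebpoly_quotientE; set q := chebpoly_quotient _ _ => E.
  have : (1 - c) * ((1 + c) * q * I) = 0 by lra.
  move=> /eqP; rewrite mulf_eq0 => /orP[/eqP h|/eqP//].
  by move: c01; rewrite -[c](subrK 1) => /andP[]; lra.
have cq : continuous_at (1 : R)
    (fun c : R => (1 + c) * chebpoly_quotient k.+1 (2 * c ^+ 2 - 1) * I).
  apply: (@continuous_fun_mul R R _ (fun=> I)); last exact: cst_continuous.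
  apply: (@continuous_fun_mul R R (fun c => 1 + c)).
    by apply: (@continuous_fun_add R R (fun=> 1) id); [exact: cst_continuous|].
  exact: continuous_quotient_double.
have I1 : (1 + 1) * chebpoly_quotient k.+1 (2 * 1 ^+ 2 - 1) * I = 0.
  apply/eqP; rewrite eq_le; apply/andP; split; last first.
    by apply: (continuous_ge0_at1 cq) => c /I0 ->.
  rewrite -oppr_ge0; have cqN := continuousN cq.
  by apply: (continuous_ge0_at1 cqN) => c /I0 E; rewrite -[leRHS]/(- _) E oppr0.
move: I1; have -> : 2 * 1 ^+ 2 - 1 = 1 :> R by ring.
rewrite chebpoly_quotient1 => /eqP.
have k0 : 0 < (1 + 1) * k.+1%:R ^+ 2 :> R by rewrite mulr_gt0// exprn_gt0// ltr0n.
by rewrite mulf_eq0 (gt_eqF k0)/= => /eqP.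
Qed.

Variables (W : T -> R) (P : probability T R).
Hypothesis bW : bounded_measurable W.
Hypothesis Wrho : forall c s x, 0 <= c -> c ^+ 2 + s ^+ 2 = 1 ->
  2 * c * W x <= W (rho c s x) + W (rho c (- s) x).
Hypothesis Pinv : rho_invariant P.

(** Substituting the inverse rotation moves the rotation from the polynomial to [W]: a summation by
    parts for the finite difference. *)
Lemma Rintegral_chebpoly_rotated k c s : c ^+ 2 + s ^+ 2 = 1 ->
  \int[P]_x (chebpoly k (Z (rho c s x)) * W x) =
  \int[P]_x (chebpoly k (Z x) * W (rho c (- s) x)).
Proof.
move=> cs; have b := bounded_measurableM (bmrho cs (bT k)) bW.
rewrite -(Rintegral_invariant (mrho (sqrN cs)) (Pinv (sqrN cs)) b).
by apply: eq_Rintegral => x _; rewrite rhoN.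
Qed.

(* The width function satisfies [W'' + W >= 0] in the sense of finite differences;
   the factor [1 - 4 k^2] is the value of [1 + d^2/dt^2] on [cos (2 k t)]. *)
Lemma Rintegral_width_ge0 n (a : nat -> R) :
  (forall z, -1 <= z <= 1 -> 0 <= \sum_(k < n) a k * chebpoly k z) ->
  0 <= \sum_(k < n) a k * (1 - 4 * k%:R ^+ 2) *
    \int[P]_x (chebpoly k (Z x) * W x).
Proof.
move=> a0; pose w k := \int[P]_x (chebpoly k (Z x) * W x).
(* (1 - c) G(c) is half the integral of psi times the finite difference of [W]; this form of the
   quotient is continuous at c = 1, where its factor becomes 1 - 4 k^2. *)
pose G c := \sum_(k < n) a k *
  (1 - 2 * (1 + c) * chebpoly_quotient k (2 * c ^+ 2 - 1)) * w k.
have -> : \sum_(k < n) a k * (1 - 4 * k%:R ^+ 2) * w k = G 1.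
  apply: eq_bigr => k _; congr (_ * _ * _).
  have -> : 2 * 1 ^+ 2 - 1 = 1 :> R by ring.
  by rewrite chebpoly_quotient1; ring.
apply: (@continuous_ge0_at1 _ G).
  apply: (@continuous_fun_sum R R n (fun k c => a k *
    (1 - 2 * (1 + c) * chebpoly_quotient k (2 * c ^+ 2 - 1)) * w k)) => k.
  apply: (@continuous_fun_mul R R _ (fun=> w k)); last exact: cst_continuous.
  apply: (@continuous_fun_mul R R (fun=> a k)); first exact: cst_continuous.
  apply: (@continuous_fun_add R R (fun=> 1)); first exact: cst_continuous.
  apply: (@continuousN R R R
    (fun c => 2 * (1 + c) * chebpoly_quotient k (2 * c ^+ 2 - 1))).
  apply: (@continuous_fun_mul R R (fun c => 2 * (1 + c))).
    apply: (@continuous_fun_mul R R (fun=> 2)); first exact: cst_continuous.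
    by apply: (@continuous_fun_add R R (fun=> 1) id); [exact: cst_continuous|].
  exact: continuous_quotient_double.
move=> c c01; have cs := sin_of c01; set s := Num.sqrt _ in cs.
have /andP[c0 c1] := c01.
suff : 0 <= (1 - c) * G c by rewrite pmulr_rge0// subr_gt0.
have -> : (1 - c) * G c =
    \sum_(k < n) a k * (chebpoly k (c ^+ 2 - s ^+ 2) - c) * w k.
  rewrite mulr_sumr; apply: eq_bigr => k _.
  have -> : c ^+ 2 - s ^+ 2 = 2 * c ^+ 2 - 1 by lra.
  by rewrite chebpoly_quotientE; ring.
pose psi x := \sum_(k < n) a k * chebpoly k (Z x).
have bpsi : bounded_measurable psi.
  apply: (@bounded_measurable_sum _ _ _ n (fun k x => a k * chebpoly k (Z x))).
  by move=> k; apply: bounded_measurableM (bT k); exact: bounded_measurable_cst.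
have int_psi V := @int_cheb_sum P V n a.
have bW1 := bmrho cs bW; have bW2 := bmrho (sqrN cs) bW.
have bcW : bounded_measurable (fun x => 2 * c * W x).
  by apply: bounded_measurableM => //; exact: bounded_measurable_cst.
(* The finite difference inequality for [W], integrated against the nonnegative [psi]. Both sides
   are then expressed by the moments [w k], after moving the rotations onto the polynomials. *)
have : \int[P]_x (psi x * (2 * c * W x)) <=
    \int[P]_x (psi x * (W (rho c s x) + W (rho c (- s) x))).
  apply: le_Rintegral_bm; first exact: bounded_measurableM.
    by apply: bounded_measurableM => //; exact: bounded_measurableD.
  by move=> x; rewrite ler_wpM2l ?a0// Wrho// ltW.
rewrite !int_psi//; last exact: bounded_measurableD.
have -> : \sum_(k < n) a k * \int[P]_x (chebpoly k (Z x) * (2 * c * W x)) =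
    2 * \sum_(k < n) a k * c * w k.
  rewrite mulr_sumr; apply: eq_bigr => k _.
  under eq_Rintegral do rewrite mulrCA.
  by rewrite Rintegral_bmZ /w; [ring|exact: bounded_measurableM].
have -> : \sum_(k < n) a k * \int[P]_x (chebpoly k (Z x) *
      (W (rho c s x) + W (rho c (- s) x))) =
    2 * \sum_(k < n) a k * chebpoly k (c ^+ 2 - s ^+ 2) * w k.
  rewrite mulr_sumr; apply: eq_bigr => k _.
  under eq_Rintegral do rewrite mulrDr.
  rewrite Rintegral_bmD; try exact: bounded_measurableM.
  have := Rintegral_chebpoly_rotated k (sqrN cs); rewrite opprK => <-.
  rewrite -(Rintegral_chebpoly_rotated k cs) addrC -Rintegral_bmD; last 2 first.
  - exact: bounded_measurableM (bmrho cs (bT k)) bW.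
  - exact: bounded_measurableM (bmrho (sqrN cs) (bT k)) bW.
  under eq_Rintegral => x _ do
    rewrite -mulrDl (chebZ _ _ cs) -[_ * chebpoly k (Z x) * W x]mulrA.
  by rewrite Rintegral_bmZ /w; [ring|exact: bounded_measurableM].
rewrite ler_pM2l// -subr_ge0 -sumrB; congr (_ <= _); apply: eq_bigr => k _; ring.
Qed.

(** Under [Q] all terms of the majorant but the constant one integrate to 0, so the first factor is
    at most [a 0]; the other two integrals are bounded or expressed linearly in the moments of [W].
    Positivity of psi - e then leaves the strict gap e times the integral of [W]. *)
Lemma Rintegral_norm_lt (Q : probability T R) (kappa : R) n (a : nat -> R)
    (e : R) : rho_invariant Q -> (2 < n)%N -> 0 < e -> 0 < \int[P]_x W x ->
  (forall x, 0 <= W x) ->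
  (forall z, -1 <= z <= 1 -> `|z + kappa| <= \sum_(k < n) a k * chebpoly k z) ->
  (forall z, -1 <= z <= 1 -> e <= \sum_(k < n) (hcoef kappa k - a 0%N * a k)
    / (1 - 4 * k%:R ^+ 2) * chebpoly k z) ->
  \int[Q]_x `|Z x + kappa| * \int[P]_x (`|Z x + kappa| * W x) <
  \int[P]_x ((Z x + kappa) ^+ 2 * W x).
Proof.
move=> Qinv n2 e0 W0 Wge0 upper width.
pose w k := \int[P]_x (chebpoly k (Z x) * W x).
(* With n >= 3 the sum contains all three nonzero entries of [hcoef]. *)
case: n n2 upper width => [|[|[|n]]]// _ upper width.
have bcst (b : R) : bounded_measurable (fun _ : T => b).
  exact: bounded_measurable_cst.
have bZ : bounded_measurable (fun x => `|Z x + kappa|).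
  apply: bounded_measurable_norm; apply: bounded_measurableD => //.
  exact: (bT 1).
have bsum : bounded_measurable (fun x => \sum_(k < n.+3) a k * chebpoly k (Z x)).
  apply: (@bounded_measurable_sum _ _ _ n.+3 (fun k x => a k * chebpoly k (Z x))).
  by move=> k; apply: bounded_measurableM.
have m_le : \int[Q]_x `|Z x + kappa| <= a 0%N.
  apply: (@le_trans _ _ (\int[Q]_x (\sum_(k < n.+3) a k * chebpoly k (Z x)))).
    by apply: le_Rintegral_bm => // x; exact: upper.
  have := @int_cheb_sum Q (cst 1) n.+3 a (bcst 1).
  under eq_Rintegral do rewrite mulr1.
  move=> ->; rewrite big_ord_recl big1 ?addr0 => [|k _].
    under eq_Rintegral do rewrite mulr1 chebpoly0.
    by rewrite Rintegral_probability_cst mulr1.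
  under eq_Rintegral do rewrite mulr1.
  by rewrite Rintegral_chebpoly// mulr0.
have B_le : \int[P]_x (`|Z x + kappa| * W x) <= \sum_(k < n.+3) a k * w k.
  rewrite -int_cheb_sum//; apply: le_Rintegral_bm; try exact: bounded_measurableM.
  by move=> x; rewrite ler_wpM2r// upper.
have sq : \int[P]_x ((Z x + kappa) ^+ 2 * W x) =
    \sum_(k < n.+3) hcoef kappa k * w k.
  rewrite -int_cheb_sum//; apply: eq_Rintegral => x _; congr (_ * _).
  rewrite !big_ord_recl big1 => [|k _]; last by rewrite /hcoef /= nth_nil mul0r.
  by rewrite /hcoef /= chebpoly0 chebpoly1 chebpolySS chebpoly0 chebpoly1; field.
(* The margin e is taken off the constant term only, where 1 - 4 k^2 = 1. *)
pose psi k := (hcoef kappa k - a 0%N * a k) / (1 - 4 * k%:R ^+ 2)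
  - (k == 0%N)%:R * e.
have psi0 z : -1 <= z <= 1 -> 0 <= \sum_(k < n.+3) psi k * chebpoly k z.
  move=> /width; rewrite -subr_ge0; congr (_ <= _).
  under [RHS]eq_bigr do rewrite mulrBl.
  rewrite sumrB; congr (_ - _); rewrite big_ord_recl/= big1 => [|k _].
    by rewrite chebpoly0 mul1r mulr1 addr0.
  by rewrite mul0r mul0r.
have := Rintegral_width_ge0 psi0.
have -> : \sum_(k < n.+3) psi k * (1 - 4 * k%:R ^+ 2) * w k =
    \sum_(k < n.+3) hcoef kappa k * w k - a 0%N * (\sum_(k < n.+3) a k * w k)
    - e * w 0%N.
  have -> : e * w 0%N = \sum_(k < n.+3) (k == 0%N :> nat)%:R * e * w k.
    by rewrite big_ord_recl/= mul1r big1 ?addr0// => k _; rewrite !mul0r.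
  rewrite mulr_sumr -!sumrB; apply: eq_bigr => k _; rewrite /psi.
  have k0 : 1 - 4 * k%:R ^+ 2 != 0 :> R.
    (* 4 k^2 is even, hence different from 1. *)
    rewrite subr_eq0 -natrX -natrM (eqr_nat R 1).
    by apply/eqP => /(congr1 odd); rewrite oddM.
  rewrite mulrBl divfK//.
  by case: eqP => [->|_]; rewrite ?expr0n /=; ring.
have w0 : 0 < w 0%N.
  by rewrite /w; under eq_Rintegral do rewrite chebpoly0 mul1r.
rewrite -sq => lb; have ew := mulr_gt0 e0 w0.
have mB : \int[Q]_x `|Z x + kappa| * \int[P]_x (`|Z x + kappa| * W x) <=
    a 0%N * (\sum_(k < n.+3) a k * w k).
  apply: ler_pM => //; apply: Rintegral_ge0 => x _ //.
  by rewrite mulr_ge0.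
by rewrite (le_lt_trans mB)//; lra.
Qed.

End rotation_invariant_trigonometry.

(** * Lines in the plane *)

Section plane_geometry.
Variable R : realType.
Implicit Types (x y u v : 'rV[R]_2) (L : linear_line R) (E : affine_line R).

Lemma dotE u v : dot u v = u 0 0 * v 0 0 + u 0 1 * v 0 1.
Proof.
rewrite /dot mxE !big_ord_recl big_ord0 addr0 !mxE.
by congr (_ + u 0 _ * v 0 _); apply: val_inj.
Qed.

Lemma row2P u v : u 0 0 = v 0 0 -> u 0 1 = v 0 1 -> u = v.
Proof.
move=> e0 e1; apply/rowP => -[[|[|//]] k2].
  by have -> : Ordinal k2 = 0 by exact: val_inj.
by have -> : Ordinal k2 = 1 by exact: val_inj.
Qed.

Definition perp v : 'rV[R]_2 := \row_k (if k == 0 then - v 0 1 else v 0 0).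

Lemma perpE0 v : perp v 0 0 = - v 0 1. Proof. by rewrite mxE. Qed.
Lemma perpE1 v : perp v 0 1 = v 0 0. Proof. by rewrite mxE. Qed.

Lemma dot_gt0 v : v != 0 -> 0 < dot v v.
Proof.
move=> v0; rewrite dotE lt_neqAle addr_ge0 ?sqr_ge0 -?expr2 ?sqr_ge0// andbT.
apply: contra v0; rewrite eq_sym paddr_eq0 ?sqr_ge0// !sqrf_eq0 => /andP[/eqP a /eqP b].
by apply/eqP/row2P; rewrite mxE.
Qed.

Lemma line_through_scale x v (a : R) : a != 0 ->
  line_through x (a *: v) = line_through x v.
Proof.
move=> a0; apply/seteqP; split=> y /= [t _ <-].
  by exists (t * a) => //; rewrite scalerA.
by exists (t / a) => //; rewrite scalerA divfK.
Qed.

Lemma unit_vectorP L :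
  dot (unit_vector L) (unit_vector L) = 1 /\
  L = line_through 0 (unit_vector L) :> set _.
Proof.
rewrite /unit_vector; case: xgetP => [u _ [uu Lu]//|/(_ _)].
have [v v0 Lv] := linear_lineP L.
pose n := Num.sqrt (dot v v); have n0 : 0 < n by rewrite sqrtr_gt0 dot_gt0.
move=> /(_ (n^-1 *: v)) []; split; last by rewrite line_through_scale ?invr_eq0 ?gt_eqF.
rewrite dotE !mxE.
transitivity (n ^-1 ^+ 2 * dot v v); first by rewrite dotE; ring.
by rewrite exprVn sqr_sqrtr ?mulVf ?gt_eqF ?dot_gt0// ltW ?dot_gt0.
Qed.

(** The sign of the factor depends on the choice made by [unit_vector]; only its square is a
    function of v, which is why quadratic expressions in the unit vector are used below. *)
Lemma unit_vector_line L v : v != 0 -> L = line_through 0 v :> set _ ->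
  exists2 a : R, unit_vector L = a *: v & a ^+ 2 * dot v v = 1.
Proof.
move=> v0 Lv; have [uu Lu] := unit_vectorP L.
have : linear_line_set L (unit_vector L) by rewrite Lu; exists 1 => //; rewrite scale1r add0r.
rewrite Lv => -[a _]; rewrite add0r => av; exists a => //.
by rewrite -uu -av !dotE !mxE; ring.
Qed.

Definition mk_linear v (v0 : v != 0) : linear_line R :=
  LinearLine (ex_intro2 _ _ v v0 erefl).

Definition mk_affine x v (v0 : v != 0) : affine_line R :=
  AffineLine (ex_intro _ x (ex_intro2 _ _ v v0 erefl)).

Lemma direction_line E x v : v != 0 -> E = line_through x v :> set _ ->
  direction E = line_through 0 v :> set _.
Proof.
move=> v0 Ev; rewrite /= Ev; apply/seteqP; split=> w /=.
  move=> [_ [s _ <-] [_ [t _ <-] <-]]; exists (s - t) => //.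
  by rewrite add0r opprD addrACA subrr add0r scalerBl.
move=> [t _ <-]; exists (x + t *: v); first by exists t.
by exists x; [exists 0 => //; rewrite scale0r addr0|rewrite addrAC subrr].
Qed.

Definition line_point E : 'rV[R]_2 := xget 0 E.

Lemma line_pointP E x : affine_line_set E x -> E = line_through x (unit_vector (direction E)) :> set _.
Proof.
have [a [v v0 Ea]] := affine_lineP E.
have [c uv cv] := unit_vector_line v0 (direction_line v0 Ea).
have c0 : c != 0.
  by apply/eqP => c0; move: cv; rewrite c0 expr0n mul0r => /eqP; rewrite eq_sym oner_eq0.
rewrite uv line_through_scale// Ea => -[t _ <-].
apply/seteqP; split=> y [s _ <-] /=.
  by exists (s - t) => //; rewrite -addrA -scalerDl [t + _]addrC subrK.
by exists (t + s) => //; rewrite scalerDl addrA.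
Qed.

Lemma line_point_mem E : affine_line_set E (line_point E).
Proof.
rewrite /line_point; case: xgetP => [x _ //|].
have [a [v v0 Ea]] := affine_lineP E.
by move=> /(_ a) []; rewrite Ea; exists 0 => //; rewrite scale0r addr0.
Qed.

Lemma mem_lineP x y u : dot u u = 1 ->
  line_through x u y <-> dot (perp u) (y - x) = 0.
Proof.
move=> uu; rewrite dotE perpE0 perpE1 !mxE; split=> [[t _ <-]|h].
  by rewrite !mxE; ring.
exists (dot u (y - x)) => //; move: uu; rewrite !dotE !mxE => uu.
set a := u 0 0 in uu h *; set b := u 0 1 in uu h *.
apply: row2P; rewrite !mxE -/a -/b.
  transitivity (x 0 0 + (a * a + b * b) * (y 0 0 - x 0 0) + b * (- b * (y 0 0 - x 0 0) + a * (y 0 1 - x 0 1))).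
    by ring.
  by rewrite uu h; ring.
transitivity (x 0 1 + (a * a + b * b) * (y 0 1 - x 0 1) - a * (- b * (y 0 0 - x 0 0) + a * (y 0 1 - x 0 1))).
  by ring.
by rewrite uu h; ring.
Qed.

End plane_geometry.

(** * Measurability and invariance on spaces of lines *)

Lemma linear_line_open_measurable (R : realType) (U : set (linear_line R)) :
  linear_line_open U -> measurable U.
Proof. by move=> oU; apply: sub_sigma_algebra. Qed.

Lemma affine_line_open_measurable (R : realType) (U : set (affine_line R)) :
  affine_line_open U -> measurable U.
Proof. by move=> oU; apply: sub_sigma_algebra. Qed.

(** Superlevel sets of F, read on spanning vectors, are open, hence open in the quotient topology.
    Lower semicontinuity is asked for instead of continuity because support functions arise as
    suprema of continuous functions. *)
Lemma lsc_linear_measurable (R : realType) (F : linear_line R -> R)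
    (G : 'rV[R]_2 -> R) :
  (forall (L : linear_line R) v, v != 0 -> L = line_through 0 v :> set _ ->
    F L = G v) ->
  (forall v c, v != 0 -> c < G v -> \forall v' \near v, c < G v') ->
  measurable_fun setT F.
Proof.
move=> FG Glsc; apply: (measurability _ (RGenOInfty.measurableE R)) => //.
move=> _ [_ [c ->] <-]; rewrite setTI; apply: linear_line_open_measurable.
rewrite /linear_line_open openE => v [v0 [L]]; rewrite /= in_itv/= andbT => cL Lv.
rewrite /interior; have := Glsc v c v0; rewrite -(FG L)// => /(_ cL) near_c.
have near_0 : nbhs v [set v : 'rV[R]_2 | v != 0].
  by apply: open_nbhs_nbhs; split => //; exact: open_vector_neq0.
apply: filterS2 near_c near_0 => v' cv' v'0; split => //.
by exists (mk_linear v'0) => //; rewrite /= in_itv/= andbT (FG _ v').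
Qed.

Lemma lsc_affine_measurable (R : realType) (F : affine_line R -> R)
    (G : 'rV[R]_2 * 'rV[R]_2 -> R) :
  (forall (E : affine_line R) x v, v != 0 -> E = line_through x v :> set _ ->
    F E = G (x, v)) ->
  (forall z c, z.2 != 0 -> c < G z -> \forall z' \near z, c < G z') ->
  measurable_fun setT F.
Proof.
move=> FG Glsc; apply: (measurability _ (RGenOInfty.measurableE R)) => //.
move=> _ [_ [c ->] <-]; rewrite setTI; apply: affine_line_open_measurable.
rewrite /affine_line_open openE => -[x v] [/= v0 [E]]; rewrite /= in_itv/= andbT => cE Ev.
rewrite /interior; have := Glsc (x, v) c v0; rewrite -(FG E)// => /(_ cE) near_c.
have near_0 : nbhs (x, v) [set z : 'rV[R]_2 * 'rV[R]_2 | z.2 != 0].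
  have : \forall v' \near v, v' != 0.
    by apply: open_nbhs_nbhs; split => //; exact: open_vector_neq0.
  by apply: cvg_snd.
apply: filterS2 near_c near_0 => -[x' v'] /= cz' v'0; split => //.
by exists (mk_affine x' v'0) => //; rewrite /= in_itv/= andbT (FG _ x' v').
Qed.

(** On representatives the map is the projection of (x, v) to v, so it is continuous for the
    quotient topologies. *)
Lemma direction_measurable (R : realType) :
  measurable_fun setT (@direction R).
Proof.
apply: (@measurability _ _ _ _ _ _ (@open (linear_line R))) => //.
move=> _ [U oU <-]; rewrite setTI; apply: affine_line_open_measurable.
have : open (snd @^-1` [set v : 'rV[R]_2 | v != 0 /\
    exists2 L : linear_line R, U L & L = line_through 0 v :> set _] :
    set ('rV[R]_2 * 'rV[R]_2)).
  by apply: open_comp (oU : linear_line_open U) => z _; exact: cvg_snd.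
rewrite /affine_line_open; congr open; apply/seteqP; split=> -[x v] /= [v0].
  move=> [L UL Lv]; split => //; exists (mk_affine x v0) => //=.
  suff -> : direction (mk_affine x v0) = L by [].
  by apply: linear_line_inj; rewrite Lv; exact: direction_line.
move=> [E UE Ev]; split => //; exists (direction E) => //.
exact: (direction_line v0 Ev).
Qed.

Lemma is_rotationP (R : realType) (Q : 'M[R]_2) : is_rotation Q ->
  forall x y : 'rV[R]_2, dot (x *m Q) (y *m Q) = dot x y.
Proof.
move=> [QQ _] x y; rewrite /dot trmx_mul mulmxA -[x *m Q *m Q^T]mulmxA QQ.
by rewrite mulmx1.
Qed.

Lemma is_rotation_neq0 (R : realType) (Q : 'M[R]_2) (v : 'rV[R]_2) : is_rotation Q ->
  v != 0 -> v *m Q != 0.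
Proof.
move=> rQ v0; apply/eqP => vQ; have := dot_gt0 v0.
by rewrite -(is_rotationP rQ) vQ dotE !mxE mul0r addr0 ltxx.
Qed.

Lemma image_line_through (R : realType) (Q : 'M[R]_2) (a x v : 'rV[R]_2) :
  [set y *m Q + a | y in line_through x v] = line_through (x *m Q + a) (v *m Q).
Proof.
apply/seteqP; split=> y /=.
  by move=> [_ [t _ <-] <-]; exists t => //; rewrite mulmxDl -scalemxAl addrAC.
move=> [t _ <-]; exists (x + t *: v); first by exists t.
by rewrite mulmxDl -scalemxAl addrAC.
Qed.

(** [xget] makes the map total in Q: for a rotation the image is a line and is the value, and the
    default L covers matrices whose image is not a line. *)
Definition rotate_line (R : realType) (Q : 'M[R]_2) (L : linear_line R) :
    linear_line R :=
  xget L [set L' : linear_line R | L' = [set x *m Q | x in L] :> set _].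

Definition move_line (R : realType) (Q : 'M[R]_2) (a : 'rV[R]_2)
    (E : affine_line R) : affine_line R :=
  xget E [set E' : affine_line R | E' = [set x *m Q + a | x in E] :> set _].

Lemma rotate_lineE (R : realType) (Q : 'M[R]_2) (L : linear_line R) v :
  is_rotation Q -> v != 0 -> L = line_through 0 v :> set _ ->
  rotate_line Q L = line_through 0 (v *m Q) :> set _.
Proof.
move=> rQ v0 Lv; have im : [set x *m Q | x in L] = line_through 0 (v *m Q).
  rewrite Lv; have := image_line_through Q 0 0 v; rewrite mul0mx addr0 => <-.
  by apply: eq_imagel => x _; rewrite addr0.
rewrite /rotate_line; case: xgetP => [L' _ /= ->//|].
by move=> /(_ (mk_linear (is_rotation_neq0 rQ v0))) []; rewrite im.
Qed.

Lemma move_lineE (R : realType) (Q : 'M[R]_2) a (E : affine_line R) x v :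
  is_rotation Q -> v != 0 -> E = line_through x v :> set _ ->
  move_line Q a E = line_through (x *m Q + a) (v *m Q) :> set _.
Proof.
move=> rQ v0 Ev; rewrite -image_line_through -Ev.
rewrite /move_line; case: xgetP => [E' _ /= ->//|].
move=> /(_ (mk_affine (x *m Q + a) (is_rotation_neq0 rQ v0))) [].
by rewrite Ev image_line_through.
Qed.

Lemma direction_move_line (R : realType) (Q : 'M[R]_2) a (E : affine_line R) :
  is_rotation Q -> direction (move_line Q a E) = rotate_line Q (direction E).
Proof.
move=> rQ; have [x [v v0 Ev]] := affine_lineP E; apply: linear_line_inj.
rewrite (direction_line (is_rotation_neq0 rQ v0) (move_lineE a rQ v0 Ev)).
by rewrite (rotate_lineE rQ v0)// (direction_line v0 Ev).
Qed.

Lemma mulmxr_continuous2 (R : realType) (Q : 'M[R]_2) :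
  continuous (fun x : 'rV[R]_2 => x *m Q).
Proof.
have -> : (fun x : 'rV[R]_2 => x *m Q) =
    fun x => x 0 0 *: row 0 Q + x 0 1 *: row 1 Q.
  apply/funext => x; apply/rowP => k.
  rewrite !mxE !big_ord_recl big_ord0 addr0; congr (_ + x 0 _ * Q _ k); exact: val_inj.
have c k : continuous (fun x : 'rV[R]_2 => x 0 k *: row k Q).
  move=> x; apply: (@cvgZr_tmp _ _ _ (nbhs x)).
  exact: (@coord_continuous _ 1 2 0 k x).
by move=> x; exact: (cvgD (c 0 x) (c 1 x)).
Qed.

Lemma rotate_line_measurable (R : realType) (Q : 'M[R]_2) : is_rotation Q ->
  measurable_fun setT (rotate_line Q).
Proof.
move=> rQ; apply: (@measurability _ _ _ _ _ _ (@open (linear_line R))) => //.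
move=> _ [U oU <-]; rewrite setTI; apply: linear_line_open_measurable.
have : open [set v : 'rV[R]_2 | v != 0].
  exact: open_vector_neq0.
have : open ((fun v => v *m Q) @^-1` [set v : 'rV[R]_2 | v != 0 /\
    exists2 L : linear_line R, U L & L = line_through 0 v :> set _]).
  by apply: open_comp (oU : linear_line_open U) => z _; exact: mulmxr_continuous2.
move=> /openI /[apply]; rewrite /linear_line_open; congr open.
apply/seteqP; split=> v /=.
  move=> [[vQ0 [L UL Lv]] v0]; split => //; exists (mk_linear v0) => //=.
  suff -> : rotate_line Q (mk_linear v0) = L by [].
  by apply: linear_line_inj; rewrite Lv; exact: rotate_lineE.
move=> [v0 [L UL Lv]]; split => //; split; first exact: is_rotation_neq0.
by exists (rotate_line Q L) => //; exact: rotate_lineE.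
Qed.

Lemma move_line_measurable (R : realType) (Q : 'M[R]_2) a : is_rotation Q ->
  measurable_fun setT (move_line Q a).
Proof.
move=> rQ; apply: (@measurability _ _ _ _ _ _ (@open (affine_line R))) => //.
move=> _ [U oU <-]; rewrite setTI; apply: affine_line_open_measurable.
have : open (snd @^-1` [set v : 'rV[R]_2 | v != 0] : set ('rV[R]_2 * 'rV[R]_2)).
  by apply: open_comp (@open_vector_neq0 R) => z _; exact: cvg_snd.
have : open ((fun z : 'rV[R]_2 * 'rV[R]_2 => (z.1 *m Q + a, z.2 *m Q)) @^-1`
    [set z : 'rV[R]_2 * 'rV[R]_2 | z.2 != 0 /\
    exists2 E : affine_line R, U E & E = line_through z.1 z.2 :> set _]).
  have c1 : continuous (fun z : 'rV[R]_2 * 'rV[R]_2 => z.1 *m Q + a).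
    move=> z; apply: (@cvgD _ _ _ _ _ (fun z => z.1 *m Q) (fun=> a)).
      apply: (@continuous_comp _ _ _ fst (fun x : 'rV[R]_2 => x *m Q)).
        exact: cvg_fst.
      exact: mulmxr_continuous2.
    exact: cvg_cst.
  have c2 : continuous (fun z : 'rV[R]_2 * 'rV[R]_2 => z.2 *m Q).
    move=> z; apply: (@continuous_comp _ _ _ snd (fun x : 'rV[R]_2 => x *m Q)).
      exact: cvg_snd.
    exact: mulmxr_continuous2.
  apply: open_comp (oU : affine_line_open U) => z _.
  exact: (cvg_pair (c1 z) (c2 z)).
move=> /openI /[apply]; rewrite /affine_line_open; congr open.
apply/seteqP; split=> -[x v] /=.
  move=> [[vQ0 [E UE Ev]] v0]; split => //; exists (mk_affine x v0) => //=.
  suff -> : move_line Q a (mk_affine x v0) = E by [].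
  by apply: affine_line_inj; rewrite Ev; exact: move_lineE.
move=> [v0 [E UE Ev]]; split => //; split; first exact: is_rotation_neq0.
by exists (move_line Q a E) => //; exact: move_lineE.
Qed.

Lemma is_rotation_tr (R : realType) (Q : 'M[R]_2) :
  is_rotation Q -> is_rotation Q^T.
Proof. by move=> [QQ dQ]; split; [rewrite trmxK; exact: mulmx1C|rewrite det_tr]. Qed.

Lemma is_rotation_trK (R : realType) (Q : 'M[R]_2) : is_rotation Q ->
  forall x : 'rV[R]_2, x *m Q^T *m Q = x.
Proof. by move=> [/mulmx1C QQ _] x; rewrite -mulmxA QQ mulmx1. Qed.

Lemma rotate_line_trK (R : realType) (Q : 'M[R]_2) (L : linear_line R) :
  is_rotation Q -> rotate_line Q (rotate_line Q^T L) = L.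
Proof.
move=> rQ; have rQt := is_rotation_tr rQ; have [v v0 Lv] := linear_lineP L.
apply: linear_line_inj; have LtE := rotate_lineE rQt v0 Lv.
by rewrite (rotate_lineE rQ (is_rotation_neq0 rQt v0) LtE) is_rotation_trK.
Qed.

Lemma rotate_line_image (R : realType) (Q : 'M[R]_2) (L : linear_line R) :
  is_rotation Q -> rotate_line Q L = [set x *m Q | x in L] :> set _.
Proof.
move=> rQ; have [v v0 Lv] := linear_lineP L; rewrite (rotate_lineE rQ v0 Lv) Lv.
have := image_line_through Q 0 0 v; rewrite mul0mx addr0 => <-.
by apply: eq_imagel => x _; rewrite addr0.
Qed.

Lemma move_line_image (R : realType) (Q : 'M[R]_2) a (E : affine_line R) :
  is_rotation Q -> move_line Q a E = [set x *m Q + a | x in E] :> set _.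
Proof.
move=> rQ; have [x [v v0 Ev]] := affine_lineP E.
by rewrite (move_lineE a rQ v0 Ev) Ev image_line_through.
Qed.

Lemma move_line_trK (R : realType) (Q : 'M[R]_2) a (E : affine_line R) :
  is_rotation Q -> move_line Q a (move_line Q^T (- (a *m Q^T)) E) = E.
Proof.
move=> rQ; have rQt := is_rotation_tr rQ; have [x [v v0 Ev]] := affine_lineP E.
apply: affine_line_inj; have EtE := move_lineE (- (a *m Q^T)) rQt v0 Ev.
rewrite (move_lineE a rQ (is_rotation_neq0 rQt v0) EtE) mulmxDl mulNmx.
by rewrite !is_rotation_trK// subrK.
Qed.

(** Invariance is stated for images of sets, while image measures need preimages. The preimage of A
    is measurable, and by surjectivity its image is A. *)
Lemma rotation_invariantP (R : realType)
    (nu : {measure set (linear_line R) -> \bar R}) Q A :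
  rotation_invariant nu -> is_rotation Q -> measurable A ->
  nu (rotate_line Q @^-1` A) = nu A.
Proof.
move=> hnu rQ mA; have mB : measurable (rotate_line Q @^-1` A).
  by rewrite -[X in measurable X]setTI; exact: rotate_line_measurable.
rewrite -(hnu _ rQ _ mB); congr (nu _).
apply/seteqP; split=> L /=.
  move=> [L' AL']; rewrite -rotate_line_image// => LL'.
  by rewrite (linear_line_inj LL').
move=> AL; exists (rotate_line Q^T L); first by rewrite /= rotate_line_trK.
by rewrite -rotate_line_image// rotate_line_trK.
Qed.

Lemma motion_invariantP (R : realType)
    (mu : {measure set (affine_line R) -> \bar R}) Q a A :
  motion_invariant mu -> is_rotation Q -> measurable A ->
  mu (move_line Q a @^-1` A) = mu A.
Proof.
move=> hmu rQ mA; have mB : measurable (move_line Q a @^-1` A).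
  by rewrite -[X in measurable X]setTI; exact: move_line_measurable.
rewrite -(hmu _ a rQ _ mB); congr (mu _).
apply/seteqP; split=> E /=.
  move=> [E' AE']; rewrite -move_line_image// => EE'.
  by rewrite (affine_line_inj EE').
move=> AE; exists (move_line Q^T (- (a *m Q^T)) E); first by rewrite /= move_line_trK.
by rewrite -move_line_image// move_line_trK.
Qed.

(** * Normals, offsets and support functions *)

Section line_functions.
Variable R : realType.
Implicit Types (x y u v w : 'rV[R]_2) (L : linear_line R) (E : affine_line R).
Implicit Types (K : set 'rV[R]_2) (a k l : 'I_2).

Definition normal L : 'rV[R]_2 := perp (unit_vector L).

Lemma dot_perp v : dot (perp v) (perp v) = dot v v.
Proof. by rewrite !dotE !perpE0 !perpE1; ring. Qed.

Lemma dotZl (c : R) u v : dot (c *: u) v = c * dot u v.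
Proof. by rewrite !dotE !mxE; ring. Qed.

Lemma dot_normal L : dot (normal L) (normal L) = 1.
Proof. by rewrite dot_perp; have [] := unit_vectorP L. Qed.

Lemma normal_sqrD L : normal L 0 0 ^+ 2 + normal L 0 1 ^+ 2 = 1.
Proof. by rewrite -(dot_normal L) dotE !expr2. Qed.

Lemma normal_line L v : v != 0 -> L = line_through 0 v :> set _ ->
  exists2 c : R, normal L = c *: perp v & c ^+ 2 = (dot v v)^-1.
Proof.
move=> v0 Lv; have [c uc cv] := unit_vector_line v0 Lv; exists c.
  by rewrite /normal uc; apply: row2P; rewrite !mxE //=; ring.
have := dot_gt0 v0 => d0; apply: (mulIf (lt0r_neq0 d0)).
by rewrite cv mulVf// gt_eqF.
Qed.

Lemma coord_continuous_at v k : continuous_at v (fun v : 'rV[R]_2 => v 0 k).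
Proof. exact: (@coord_continuous _ 1 2 0 k v). Qed.

Lemma perp_continuous_at v k : continuous_at v (fun v : 'rV[R]_2 => perp v 0 k).
Proof.
rewrite (_ : (fun v => _) = if k == 0 then fun v : 'rV[R]_2 => - v 0 1 else
    fun v : 'rV[R]_2 => v 0 0); last first.
  by apply/funext => w; rewrite mxE; case: ifP.
case: ifP => _; last exact: coord_continuous_at.
by apply: (@cvgN _ _ _ (nbhs v)); exact: coord_continuous_at.
Qed.

Lemma dot_continuous_at (T : topologicalType) (f g : T -> 'rV[R]_2) (t : T) :
  (forall k, continuous_at t (fun t => f t 0 k)) ->
  (forall k, continuous_at t (fun t => g t 0 k)) ->
  continuous_at t (fun t => dot (f t) (g t)).
Proof.
move=> cf cg; rewrite (_ : (fun t => _) =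
    fun t => f t 0 0 * g t 0 0 + f t 0 1 * g t 0 1); last first.
  by apply/funext => s; rewrite dotE.
apply: (@continuous_fun_add T R (fun t => f t 0 0 * g t 0 0)
  (fun t => f t 0 1 * g t 0 1)).
  exact: (@continuous_fun_mul T R (fun t => f t 0 0) (fun t => g t 0 0)).
exact: (@continuous_fun_mul T R (fun t => f t 0 1) (fun t => g t 0 1)).
Qed.

Lemma dotV_continuous_at v : v != 0 ->
  continuous_at v (fun v : 'rV[R]_2 => (dot v v)^-1).
Proof.
move=> v0; apply: (@cvgV _ _ (nbhs v) _ (fun v => dot v v) (dot v v)).
  by rewrite gt_eqF// dot_gt0.
by apply: dot_continuous_at => k; exact: coord_continuous_at.
Qed.

Lemma continuous_at_lsc (T : topologicalType) (G : T -> R) t c :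
  continuous_at t G -> c < G t -> \forall t' \near t, c < G t'.
Proof. by move=> cG cGt; exact: (cvgr_gt (G t) cG). Qed.

(* [conormal a L] is the projection of the [a]-th basis vector onto the normal of
   [L]; unlike the normal itself it does not depend on an orientation of [L]. *)
Definition conormal a L : 'rV[R]_2 := normal L 0 a *: normal L.

Lemma conormal_line a L v : v != 0 -> L = line_through 0 v :> set _ ->
  conormal a L = (perp v 0 a / dot v v) *: perp v.
Proof.
move=> v0 Lv; have [c nc c2] := normal_line v0 Lv.
rewrite /conormal nc scalerA; congr (_ *: _).
by rewrite mxE -c2; ring.
Qed.

Lemma dot_conormal a L x : dot (conormal a L) x = normal L 0 a * dot (normal L) x.
Proof. exact: dotZl. Qed.

Lemma conormal_continuous_at a k v : v != 0 ->
  continuous_at v (fun v => perp v 0 a * (dot v v)^-1 * perp v 0 k).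
Proof.
move=> v0; apply: (@continuous_fun_mul _ _ (fun v => perp v 0 a * (dot v v)^-1)
    (fun v => perp v 0 k)); last exact: perp_continuous_at.
apply: (@continuous_fun_mul _ _ (fun v => perp v 0 a) (fun v => (dot v v)^-1)).
  exact: perp_continuous_at.
exact: dotV_continuous_at.
Qed.

Lemma dot_conormal_continuous_at a v (s : R) x : v != 0 ->
  continuous_at v (fun v => dot ((s * (perp v 0 a / dot v v)) *: perp v) x).
Proof.
move=> v0; rewrite (_ : (fun v => _) = fun v =>
    (s * x 0 0) * (perp v 0 a * (dot v v)^-1 * perp v 0 0) +
    (s * x 0 1) * (perp v 0 a * (dot v v)^-1 * perp v 0 1)); last first.
  by apply/funext => w; rewrite dotZl [dot _ x]dotE; ring.
have cp k := @conormal_continuous_at a k v v0.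
apply: (@continuous_fun_add _ _
  (fun v => (s * x 0 0) * (perp v 0 a * (dot v v)^-1 * perp v 0 0))
  (fun v => (s * x 0 1) * (perp v 0 a * (dot v v)^-1 * perp v 0 1))).
  apply: (@continuous_fun_mul _ _ (fun=> s * x 0 0)
    (fun v => perp v 0 a * (dot v v)^-1 * perp v 0 0)) => //.
  exact: cst_continuous.
apply: (@continuous_fun_mul _ _ (fun=> s * x 0 1)
  (fun v => perp v 0 a * (dot v v)^-1 * perp v 0 1)) => //.
exact: cst_continuous.
Qed.

(* With n = normal (direction E), this is n_a^2 times the intercept of E on the
   a-th coordinate axis; the factor keeps it defined when E is parallel to the
   axis, and the value does not depend on the sign of n. *)
Definition offset a E : R := dot (conormal a (direction E)) (line_point E).

Lemma normal_unit_vector L : dot (normal L) (unit_vector L) = 0.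
Proof. by rewrite dotE perpE0 perpE1; ring. Qed.

(** Two points of E differ by a multiple of its unit vector, to which the normal is orthogonal; the
    arbitrary [line_point] is thus immaterial. *)
Lemma offset_mem a E x : affine_line_set E x ->
  offset a E = dot (conormal a (direction E)) x.
Proof.
move=> Ex; have := line_point_mem E; rewrite (line_pointP Ex) => -[t _ tE].
rewrite /offset -tE !dot_conormal; congr (_ * _).
transitivity (dot (normal (direction E)) x +
  t * dot (normal (direction E)) (unit_vector (direction E))).
  by rewrite !dotE !mxE; ring.
by rewrite normal_unit_vector mulr0 addr0.
Qed.

Lemma mem_normalP E x y : affine_line_set E x ->
  affine_line_set E y <-> dot (normal (direction E)) y = dot (normal (direction E)) x.
Proof.
move=> Ex; rewrite (line_pointP Ex).
apply: (iff_trans (mem_lineP _ _ _)); first by have [] := unit_vectorP (direction E).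
rewrite -/(normal (direction E)).
have -> : dot (normal (direction E)) (y - x) =
    dot (normal (direction E)) y - dot (normal (direction E)) x.
  by rewrite !dotE !mxE; ring.
by split=> [/eqP|->]; rewrite ?subrr// subr_eq0 => /eqP.
Qed.

Lemma offset_measurable a : measurable_fun setT (offset a).
Proof.
pose q k (z : 'rV[R]_2 * 'rV[R]_2) : R :=
  perp z.2 0 a * (dot z.2 z.2)^-1 * perp z.2 0 k.
apply: (@lsc_affine_measurable _ _ (fun z => q 0 z * z.1 0 0 + q 1 z * z.1 0 1)).
  move=> E x v v0 Ev; rewrite (@offset_mem _ _ x); last first.
    by rewrite Ev; exists 0 => //; rewrite scale0r addr0.
  by rewrite (conormal_line _ v0 (direction_line v0 Ev)) dotZl [dot _ x]dotE /q /=; ring.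
move=> z c /= v0; apply: (@continuous_at_lsc _
  (fun z => q 0 z * z.1 0 0 + q 1 z * z.1 0 1)).
have cq k : continuous_at z (q k).
  apply: (@continuous_comp _ _ _ snd
    (fun v => perp v 0 a * (dot v v)^-1 * perp v 0 k)); first exact: cvg_snd.
  exact: conormal_continuous_at.
have c1 k : continuous_at z (fun z : 'rV[R]_2 * 'rV[R]_2 => z.1 0 k).
  apply: (@continuous_comp _ _ _ fst (fun v : 'rV[R]_2 => v 0 k)).
    exact: cvg_fst.
  exact: coord_continuous_at.
apply: (@continuous_fun_add _ _ (fun z => q 0 z * z.1 0 0)
  (fun z => q 1 z * z.1 0 1)).
  exact: (@continuous_fun_mul _ _ (q 0) (fun z => z.1 0 0)).
exact: (@continuous_fun_mul _ _ (q 1) (fun z => z.1 0 1)).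
Qed.

Definition support K w : R := sup [set dot w k | k in K].

Lemma dot_CauchySchwarz v w : dot v w ^+ 2 <= dot v v * dot w w.
Proof.
rewrite -subr_ge0 (_ : _ - _ = (v 0 0 * w 0 1 - v 0 1 * w 0 0) ^+ 2) ?sqr_ge0//.
by rewrite !dotE; ring.
Qed.

Lemma discP r x : 0 < r -> disc r x <-> dot x x <= r ^+ 2.
Proof.
move=> r0; rewrite /disc /=.
suff -> : (Num.sqrt (dot x x) <= r) = (dot x x <= r ^+ 2) by [].
by rewrite -{1}[r](ger0_norm (ltW r0)) -sqrtr_sqr ler_sqrt// exprn_ge0// ltW.
Qed.

Lemma disc_dot r v x : 0 < r -> disc r x -> `|dot v x| <= Num.sqrt (dot v v) * r.
Proof.
have dge0 : 0 <= dot v v by rewrite dotE addr_ge0// -expr2 sqr_ge0.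
move=> r0 /(discP _ r0) xr; rewrite -[r](ger0_norm (ltW r0)) -!sqrtr_sqr -sqrtrM//.
rewrite ler_wsqrtr// (le_trans (dot_CauchySchwarz v x))//.
by rewrite ler_wpM2l.
Qed.

Lemma support_has_sup K r w : 0 < r -> K !=set0 -> K `<=` disc r ->
  has_sup [set dot w k | k in K].
Proof.
move=> r0 [k Kk] Kr; split; first by exists (dot w k); exists k.
exists (Num.sqrt (dot w w) * r) => _ [x Kx <-].
by rewrite (le_trans (ler_norm _))// disc_dot//; exact: Kr.
Qed.

Lemma dot_le_support K r w x : 0 < r -> K `<=` disc r -> K x ->
  dot w x <= support K w.
Proof.
move=> r0 Kr Kx; apply: sup_upper_bound; last by exists x.
by apply: (support_has_sup _ r0) => //; exists x.
Qed.

Lemma support_le K (m : R) w : K !=set0 -> (forall x, K x -> dot w x <= m) ->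
  support K w <= m.
Proof.
move=> [k Kk] Km; apply: ge_sup; first by exists (dot w k); exists k.
by move=> _ [x Kx <-]; exact: Km.
Qed.

(** If the supremum exceeds c, some k in K already does so, and by continuity it still does for
    nearby spanning vectors. The values 1 and -1 of s give the two sides of the slab containing
    K. *)
Lemma support_conormal_measurable K r a (s : R) : 0 < r -> K !=set0 ->
  K `<=` disc r -> measurable_fun setT (fun L => support K (s *: conormal a L)).
Proof.
move=> r0 K0 Kr; pose G v := support K ((s * (perp v 0 a / dot v v)) *: perp v).
apply: (@lsc_linear_measurable _ _ G).
  by move=> L v v0 Lv; rewrite (conormal_line a v0 Lv) scalerA.
move=> v c v0 cG; have [_ [k Kk <-] ck] : exists2 y,
    [set dot ((s * (perp v 0 a / dot v v)) *: perp v) k | k in K] y & c < y.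
  by apply: sup_gt => //; case: K0 => k Kk; exists (dot ((s * (perp v 0 a / dot v v)) *: perp v) k); exists k.
have near_k := @continuous_at_lsc _ _ v c (@dot_conormal_continuous_at a v s k v0) ck.
apply: (filterS _ near_k).
by move=> v' /lt_le_trans; apply; exact: (dot_le_support _ r0).
Qed.

(** As n_a is nonzero, the offset determines the line among its parallels. Compactness provides
    points of K where the linear form [w] is extremal, and convexity provides every value in
    between. *)
Lemma hitting_slab K r a E : 0 < r -> K !=set0 -> K `<=` disc r ->
  convex_body K -> normal (direction E) 0 a != 0 ->
  hitting K E <-> - support K (-1 *: conormal a (direction E)) <= offset a E <=
    support K (1 *: conormal a (direction E)).
Proof.
move=> r0 K0 Kr [Kc Kconv] na; rewrite scaleN1r scale1r; split.
  move=> [x [Ex Kx]]; rewrite (offset_mem a Ex) (dot_le_support _ r0)// andbT.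
  rewrite lerNl (le_trans _ (dot_le_support _ r0 Kr Kx))//.
  by rewrite !dotE !mxE; lra.
set w := conormal a (direction E) => /andP[lo hi].
have cdot : {within K, continuous (dot w)}.
  apply: continuous_subspaceT => x; apply: dot_continuous_at => k.
    exact: cst_continuous.
  exact: coord_continuous_at.
have [k1 Kk1 k1min] := EVT_min_rV K0 Kc cdot.
have [k2 Kk2 k2max] := EVT_max_rV K0 Kc cdot.
have lo' : dot w k1 <= offset a E.
  rewrite (le_trans _ lo)// lerNr; apply: support_le => // k Kk.
  have := k1min k (mem_set Kk); rewrite !dotE !mxE; lra.
have hi' : offset a E <= dot w k2.
  by rewrite (le_trans hi)//; apply: support_le => // k Kk; exact/k2max/mem_set.
have [k [Kk kE]] : exists k : 'rV[R]_2, K k /\ dot w k = offset a E.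
  (* If the extreme values coincide, there is no segment to divide and either extremal point
     serves. *)
  have [e|ne] := eqVneq (dot w k1) (dot w k2).
    exists k1; split; [exact: set_mem|].
    by apply/eqP; rewrite eq_le lo'/= e hi'.
  have lt12 : 0 < dot w k2 - dot w k1.
    by rewrite subr_gt0 lt_neqAle ne (le_trans lo').
  (* The weight at which the affine function along the segment from k2 to k1 takes the value of the
     offset. *)
  pose t := (dot w k2 - offset a E) / (dot w k2 - dot w k1).
  have t01 : 0 <= t <= 1.
    rewrite /t divr_ge0 ?subr_ge0 ?(ltW lt12)//=; last by move: lt12; rewrite subr_gt0 => /ltW.
    by rewrite ler_pdivrMr// mul1r lerB.
  have /andP[t0 t1] := t01.
  have := Kconv k1 k2 (Itv01 t0 t1) Kk1 Kk2; rewrite inE => Kk.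
  eexists; split; first exact: Kk.
  transitivity (dot w (t *: k1 + (1 - t) *: k2)); first by [].
  transitivity (dot w k2 - t * (dot w k2 - dot w k1)).
    by rewrite !dotE !mxE; ring.
  by rewrite /t divfK ?gt_eqF//; ring.
exists k; split => //; apply/(mem_normalP k (line_point_mem E)).
by apply: (mulfI na); rewrite -!dot_conormal.
Qed.

(** The point of the line closest to the origin is p n, with n the unit normal and p the signed
    distance, so the condition is |p| <= r multiplied by |n_a|. *)
Lemma hitting_disc_slab r a E : 0 < r -> normal (direction E) 0 a != 0 ->
  hitting (disc r) E <->
  - (r * `|normal (direction E) 0 a|) <= offset a E <= r * `|normal (direction E) 0 a|.
Proof.
move=> r0 na; rewrite -ler_norml; set n := normal (direction E).
have nn : dot n n = 1 := dot_normal _.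
rewrite /offset dot_conormal normrM mulrC ler_pM2r ?normr_gt0//.
set p := dot n _; split.
  move=> [x [Ex Dx]]; have -> : p = dot n x.
    by symmetry; apply/(mem_normalP x (line_point_mem E)).
  by rewrite (le_trans (disc_dot n r0 Dx))// nn sqrtr1 mul1r.
move=> pr; exists (p *: n); split.
  by apply/(mem_normalP _ (line_point_mem E)); rewrite -/n -/p -[RHS]mulr1 -nn !dotE !mxE; ring.
apply/(discP _ r0); have -> : dot (p *: n) (p *: n) = p ^+ 2.
  by rewrite -[RHS]mulr1 -nn !dotE !mxE; ring.
by rewrite -[p ^+ 2]real_normK ?num_real// ler_sqr ?nnegrE// ltW.
Qed.

Lemma normr_normal_measurable a :
  measurable_fun setT (fun L => `|normal L 0 a|).
Proof.
apply: (@lsc_linear_measurable _ _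
  (fun v => Num.sqrt (perp v 0 a * (dot v v)^-1 * perp v 0 a))).
  move=> L v v0 Lv; have [c nc c2] := normal_line v0 Lv.
  rewrite nc -sqrtr_sqr mxE; congr Num.sqrt; rewrite -c2; ring.
move=> v c v0; apply: (@continuous_at_lsc _
  (fun v => Num.sqrt (perp v 0 a * (dot v v)^-1 * perp v 0 a))).
apply: (@continuous_comp _ _ _ (fun v => perp v 0 a * (dot v v)^-1 * perp v 0 a) Num.sqrt).
  exact: conormal_continuous_at.
exact: sqrt_continuous.
Qed.

End line_functions.

(** * Rotations and widths *)

Section width_function.
Variable R : realType.
Implicit Types (x y u v w : 'rV[R]_2) (L : linear_line R) (E : affine_line R).
Implicit Types (K : set 'rV[R]_2) (a k l : 'I_2).

Lemma rowZE (c : R) v k : (c *: v) 0 k = c * v 0 k. Proof. by rewrite mxE. Qed.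

Lemma rowNE v k : (- v) 0 k = - v 0 k. Proof. by rewrite mxE. Qed.

Lemma normal_prod_measurable k l :
  measurable_fun setT (fun L => normal L 0 k * normal L 0 l).
Proof.
apply: (@lsc_linear_measurable _ _
  (fun v => perp v 0 k * (dot v v)^-1 * perp v 0 l)).
  move=> L v v0 Lv; have [c nc c2] := normal_line v0 Lv.
  rewrite nc !rowZE -c2; ring.
move=> v c v0; apply: (@continuous_at_lsc _ _
  (fun v => perp v 0 k * (dot v v)^-1 * perp v 0 l)).
exact: conormal_continuous_at.
Qed.

(** Transposed with respect to the usual form because it acts on row vectors from the right; x is
    turned counterclockwise. *)
Definition rotation_matrix (c s : R) : 'M[R]_2 :=
  \matrix_(i, j) if i == j then c else if i == 0 then s else - s.

Lemma mulmx_rotation_matrix c s x :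
  (x *m rotation_matrix c s) 0 0 = c * x 0 0 - s * x 0 1 /\
  (x *m rotation_matrix c s) 0 1 = s * x 0 0 + c * x 0 1.
Proof.
have e : lift ord0 ord0 = 1 :> 'I_2 by exact: val_inj.
rewrite !mxE !big_ord_recl !big_ord0 !mxE e /=; split; ring.
Qed.

Lemma tr_rotation_matrix c s : (rotation_matrix c s)^T = rotation_matrix c (- s).
Proof.
apply/matrixP => i j; rewrite !mxE eq_sym; case: eqP => // ij.
by case: i j ij => [[|[|//]] ?] [[|[|//]] ?] //=; rewrite ?opprK// => [[]]; exact: val_inj.
Qed.

Lemma rotation_matrixP c s : c ^+ 2 + s ^+ 2 = 1 ->
  is_rotation (rotation_matrix c s).
Proof.
move=> cs; split; last first.
  rewrite (expand_det_row _ ord0) !big_ord_recl big_ord0 /cofactor !det_mx11 !mxE /=.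
  by rewrite /bump /= expr0 expr1 -[RHS]cs; ring.
apply/matrixP => i j; rewrite !mxE !big_ord_recl big_ord0 !mxE addr0.
by case: i j => [[|[|//]] ?] [[|[|//]] ?] /=; rewrite ?mulr1n ?mulr0n -?[RHS]cs; ring.
Qed.

Lemma unit_vector_rotate (Q : 'M[R]_2) L : is_rotation Q ->
  unit_vector (rotate_line Q L) = unit_vector L *m Q \/
  unit_vector (rotate_line Q L) = - (unit_vector L *m Q).
Proof.
move=> rQ; have [uu Lu] := unit_vectorP L.
have u0 : unit_vector L != 0.
  by apply/eqP => u0; move: uu; rewrite u0 dotE !mxE mul0r addr0 => /eqP; rewrite eq_sym oner_eq0.
have [ww Lw] := unit_vectorP (rotate_line Q L).
apply: dot_line_through_eq => //; first by rewrite is_rotationP.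
by rewrite -Lw (rotate_lineE rQ u0 Lu).
Qed.

(** Doubling the angle removes the sign ambiguity of the unit vector. *)
Definition cos2 L : R := unit_vector L 0 0 ^+ 2 - unit_vector L 0 1 ^+ 2.
Definition sin2 L : R := 2 * unit_vector L 0 0 * unit_vector L 0 1.

Lemma cos2_measurable : measurable_fun setT cos2.
Proof.
rewrite (_ : cos2 = fun L => normal L 0 1 * normal L 0 1 - normal L 0 0 * normal L 0 0).
  by apply: measurable_funB; exact: normal_prod_measurable.
by apply/funext => L; rewrite /cos2 perpE0 perpE1; ring.
Qed.

Lemma sin2_measurable : measurable_fun setT sin2.
Proof.
rewrite (_ : sin2 = fun L => - 2 * (normal L 0 0 * normal L 0 1)).
  by apply: measurable_funM; [exact: measurable_cst|exact: normal_prod_measurable].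
by apply/funext => L; rewrite /sin2 perpE0 perpE1; ring.
Qed.

Lemma cos2_sin2 L : cos2 L ^+ 2 + sin2 L ^+ 2 = 1.
Proof.
have [uu _] := unit_vectorP L; rewrite /cos2 /sin2.
transitivity (dot (unit_vector L) (unit_vector L) ^+ 2); last by rewrite uu expr1n.
by rewrite dotE; ring.
Qed.

Lemma cos2_rotate c s L : c ^+ 2 + s ^+ 2 = 1 ->
  cos2 (rotate_line (rotation_matrix c s) L) =
  (c ^+ 2 - s ^+ 2) * cos2 L - 2 * c * s * sin2 L.
Proof.
move=> /rotation_matrixP /unit_vector_rotate -/(_ L).
have [e0 e1] := mulmx_rotation_matrix c s (unit_vector L).
by rewrite /cos2 /sin2; case=> ->; rewrite ?rowNE e0 e1; ring.
Qed.

Lemma sin2_rotate c s L : c ^+ 2 + s ^+ 2 = 1 ->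
  sin2 (rotate_line (rotation_matrix c s) L) =
  (c ^+ 2 - s ^+ 2) * sin2 L + 2 * c * s * cos2 L.
Proof.
move=> /rotation_matrixP /unit_vector_rotate -/(_ L).
have [e0 e1] := mulmx_rotation_matrix c s (unit_vector L).
by rewrite /cos2 /sin2; case=> ->; rewrite ?rowNE e0 e1; ring.
Qed.

Definition width K w : R := support K w + support K (- w).

Definition line_width K L : R := width K (normal L).

Section bounded_body.
Variables (K : set 'rV[R]_2) (r : R).
Hypotheses (r0 : 0 < r) (K0 : K !=set0) (Kr : K `<=` disc r).

Lemma supportD v w : support K (v + w) <= support K v + support K w.
Proof.
apply: support_le => // x Kx.
have -> : dot (v + w) x = dot v x + dot w x by rewrite !dotE !mxE; ring.
by apply: lerD; exact: (dot_le_support _ r0).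
Qed.

Lemma supportZ (c : R) w : 0 <= c -> support K (c *: w) = c * support K w.
Proof.
have le c' w' : 0 <= c' -> support K (c' *: w') <= c' * support K w'.
  move=> c0; apply: support_le => // x Kx; rewrite dotZl ler_wpM2l//.
  exact: (dot_le_support _ r0).
rewrite le_eqVlt => /predU1P[<-|c0].
  have [x Kx] := K0; rewrite mul0r scale0r; apply/eqP; rewrite eq_le; apply/andP; split.
    by apply: support_le => // y Ky; rewrite dotE !mxE; lra.
  by have := dot_le_support 0 r0 Kr Kx; rewrite dotE !mxE !mul0r addr0.
(* The reverse inequality is [le] for the factor c^-1 and the vector c w. *)
apply/eqP; rewrite eq_le le ?(ltW c0)//= -ler_pdivlMl//.
have := le c^-1 (c *: w); rewrite scalerA mulVf ?gt_eqF// scale1r; apply.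
by rewrite invr_ge0 ltW.
Qed.

Lemma widthN w : width K (- w) = width K w.
Proof. by rewrite /width opprK addrC. Qed.

Lemma widthZ (c : R) w : width K (c *: w) = `|c| * width K w.
Proof.
have [c0|c0] := leP 0 c.
  by rewrite ger0_norm// /width -scalerN !supportZ// mulrDr.
rewrite -widthN -scaleNr ltr0_norm// /width -scalerN !supportZ ?oppr_ge0 ?ltW//.
by rewrite mulrDr.
Qed.

Lemma widthD v w : width K (v + w) <= width K v + width K w.
Proof.
by rewrite /width opprD addrACA; apply: lerD; exact: supportD.
Qed.

Lemma le_width w x y : K x -> K y -> `|dot w (x - y)| <= width K w.
Proof.
move=> Kx Ky; have := dot_le_support w r0 Kr Kx.
have := dot_le_support (- w) r0 Kr Ky; have := dot_le_support w r0 Kr Ky.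
have := dot_le_support (- w) r0 Kr Kx; rewrite /width ler_norml !dotE !mxE.
by move=> *; apply/andP; split; lra.
Qed.

Lemma line_width_ge0 L : 0 <= line_width K L.
Proof.
have [x Kx] := K0; apply: le_trans (le_width (normal L) Kx Kx); exact: normr_ge0.
Qed.

Lemma line_width_le L : line_width K L <= r + r.
Proof.
rewrite /line_width /width; apply: lerD; apply: support_le => // x /Kr Dx.
  apply: le_trans (ler_norm _) _; apply: le_trans (disc_dot _ r0 Dx) _.
  by rewrite dot_normal sqrtr1 mul1r.
apply: le_trans (ler_norm _) _; apply: le_trans (disc_dot _ r0 Dx) _.
have -> : dot (- normal L) (- normal L) = 1.
  by rewrite -(dot_normal L) !dotE !mxE; ring.
by rewrite sqrtr1 mul1r.
Qed.

Lemma width_conormal a L :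
  width K (conormal a L) = `|normal L 0 a| * line_width K L.
Proof. exact: widthZ. Qed.

(** The normal involves a choice of sign, so the width is recovered from the conormals: their widths
    are |n_a| times it, and n_0^2 + n_1^2 = 1. *)
Lemma line_width_measurable : measurable_fun setT (line_width K).
Proof.
pose W a L := support K (1 *: conormal a L) + support K (-1 *: conormal a L).
rewrite (_ : line_width K = fun L =>
    `|normal L 0 0| * W 0 L + `|normal L 0 1| * W 1 L).
  have mW a : measurable_fun setT (W a).
    by apply: measurable_funD; exact: (support_conormal_measurable _ _ r0).
  by apply: measurable_funD; apply: measurable_funM => //; exact: normr_normal_measurable.
apply/funext => L; rewrite /W !scale1r !scaleN1r -!/(width _ _) !width_conormal.
by rewrite !mulrA -mulrDl -!expr2 !real_normK ?num_real// normal_sqrD mul1r.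
Qed.

Lemma bounded_measurable_line_width : bounded_measurable (line_width K).
Proof.
split; first exact: line_width_measurable.
by exists (r + r) => L; rewrite ger0_norm ?line_width_ge0// line_width_le.
Qed.

(** The normal rotated by an angle and by its opposite adds up to 2 c n, and the width is
    sublinear. *)
Lemma line_width_rotate_ge c s L : 0 <= c -> c ^+ 2 + s ^+ 2 = 1 ->
  2 * c * line_width K L <= line_width K (rotate_line (rotation_matrix c s) L) +
    line_width K (rotate_line (rotation_matrix c (- s)) L).
Proof.
move=> c0 cs; pose n := normal L.
have rot s' : c ^+ 2 + s' ^+ 2 = 1 ->
    line_width K (rotate_line (rotation_matrix c s') L) =
    width K (n *m rotation_matrix c s').
  move=> cs'; have [e0 e1] := mulmx_rotation_matrix c s' (unit_vector L).
  have [f0 f1] := mulmx_rotation_matrix c s' n.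
  have pe : perp (unit_vector L *m rotation_matrix c s') = n *m rotation_matrix c s'.
    by apply: row2P; rewrite ?perpE0 ?perpE1 ?e0 ?e1 ?f0 ?f1 /n perpE0 perpE1; ring.
  rewrite /line_width /normal.
  have [->|->] := unit_vector_rotate L (rotation_matrixP cs'); first by rewrite pe.
  rewrite -pe -widthN; congr width; apply: row2P.
    by rewrite rowNE !perpE0 rowNE opprK.
  by rewrite rowNE !perpE1 rowNE opprK.
rewrite rot// rot ?sqrrN//; apply: le_trans (widthD _ _).
have [f0 f1] := mulmx_rotation_matrix c s n.
have [g0 g1] := mulmx_rotation_matrix c (- s) n.
have -> : n *m rotation_matrix c s + n *m rotation_matrix c (- s) = (2 * c) *: n.
  by apply: row2P; rewrite mxE [RHS]mxE ?f0 ?f1 ?g0 ?g1; ring.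
by rewrite widthZ ger0_norm// mulr_ge0.
Qed.

End bounded_body.
End width_function.

(** * The integral inequality for the weights g_ij *)

Section line_weight_inequality.
Variable R : realType.
Implicit Types (L : linear_line R) (K : set 'rV[R]_2) (i j : 'I_2).

Definition axis i j L : R :=
  if i == j then if i == 0 then cos2 L else - cos2 L else sin2 L.

(** The partner of [axis] shifted by a quarter period, so that a rotation turns the pair by twice
    its angle for every choice of i and j. *)
Definition coaxis i j L : R :=
  if i == j then if i == 0 then sin2 L else - sin2 L else - cos2 L.

Definition shift i j : R := if i == j then 1 / 3 else 0.

(** The double angle formulas 2 u_1^2 = 1 + cos 2t, 2 u_2^2 = 1 - cos 2t and 2 u_1 u_2 = sin 2t; the
    constant 1 - 2/3 leaves the shift 1/3. *)
Lemma line_weight_axis i j L :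
  line_weight i j L = 3 / 16 * (axis i j L + shift i j).
Proof.
rewrite /line_weight /axis /shift /cos2 /sin2.
have [uu _] := unit_vectorP L; move: uu; rewrite dotE; set u := unit_vector L => uu.
have uu2 : u 0 1 * u 0 1 = 1 - u 0 0 * u 0 0 by rewrite -uu; ring.
have [<-|ij] := eqVneq i j.
  case: ifP => [/eqP ->|i0]; first by rewrite !expr2 uu2; field.
  have -> : i = 1 by case: i i0 => [[|[|//]] ?] //= _; exact: val_inj.
  by rewrite !expr2 uu2; field.
have -> : u 0 i * u 0 j = u 0 0 * u 0 1.
  case: i j ij => [[|[|//]] ?] [[|[|//]] ?] //= _; [|rewrite mulrC];
    by congr (u 0 _ * u 0 _); exact: val_inj.
by field.
Qed.

Lemma axis_measurable i j : measurable_fun setT (axis i j).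
Proof.
rewrite /axis; case: eqP => _; last exact: sin2_measurable.
by case: eqP => _; [|apply: measurable_funN]; exact: cos2_measurable.
Qed.

Lemma axis_coaxis i j L : axis i j L ^+ 2 + coaxis i j L ^+ 2 = 1.
Proof.
rewrite -(cos2_sin2 L) /axis /coaxis.
by case: eqP => _; [case: eqP => _|]; rewrite ?sqrrN// addrC.
Qed.

Lemma axis_rotate i j c s L : c ^+ 2 + s ^+ 2 = 1 ->
  axis i j (rotate_line (rotation_matrix c s) L) =
  (c ^+ 2 - s ^+ 2) * axis i j L - 2 * c * s * coaxis i j L.
Proof.
move=> cs; rewrite /axis /coaxis (cos2_rotate L cs) (sin2_rotate L cs).
by case: eqP => _; [case: eqP => _|]; ring.
Qed.

Lemma line_weight_measurable i j : measurable_fun setT (@line_weight R i j).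
Proof.
rewrite (_ : @line_weight R i j = fun L => 3 / 16 * (axis i j L + shift i j)).
  apply: measurable_funM; first exact: measurable_cst.
  by apply: measurable_funD; [exact: axis_measurable|exact: measurable_cst].
by apply/funext => L; exact: line_weight_axis.
Qed.

Lemma bounded_measurable_line_weight i j :
  bounded_measurable (@line_weight R i j).
Proof.
split; first exact: line_weight_measurable.
exists 1 => L; rewrite line_weight_axis.
have := axis_coaxis i j L; have := sqr_ge0 (coaxis i j L).
set z := axis _ _ _; set w := coaxis _ _ _ => w0 zw.
have [z1 z2] : z <= 1 /\ -1 <= z by split; nra.
by rewrite /shift ler_norml; case: ifP => _; apply/andP; split; lra.
Qed.

Variables (K : set 'rV[R]_2) (r : R).
Hypotheses (r0 : 0 < r) (Kr : K `<=` disc r).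
Hypothesis K2 : exists x y, [/\ K x, K y & x != y].

Let K0 : K !=set0. Proof. by have [x [y [Kx _ _]]] := K2; exists x. Qed.

Lemma rotation_rho_invariant (P : probability (linear_line R) R) :
  rotation_invariant P ->
  rho_invariant (fun c s => rotate_line (rotation_matrix c s)) P.
Proof.
move=> hP c s cs A mA; apply: rotation_invariantP => //.
exact: rotation_matrixP.
Qed.

(** For distinct x and y in K, the widths in two perpendicular directions add up to at least |x -
    y|, because |a| + |b| >= sqrt (a^2 + b^2). Invariance under a quarter turn gives both widths the
    same integral. *)
Lemma Rintegral_line_width_gt0 (P : probability (linear_line R) R) :
  rotation_invariant P -> 0 < \int[P]_L line_width K L.
Proof.
move=> /rotation_rho_invariant Pinv; have [x [y [Kx Ky xy]]] := K2.
have cs : 0 ^+ 2 + 1 ^+ 2 = 1 :> R by rewrite expr0n expr1n add0r.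
have bW := bounded_measurable_line_width r0 K0 Kr.
have mrot := rotate_line_measurable (rotation_matrixP cs).
set rot := rotate_line _ in mrot.
have d0 : 0 < Num.sqrt (dot (x - y) (x - y)).
  by rewrite sqrtr_gt0 dot_gt0// subr_eq0.
have : \int[P]_L Num.sqrt (dot (x - y) (x - y)) <=
    \int[P]_L (line_width K L + line_width K (rot L)).
  apply: le_Rintegral_bm; first exact: bounded_measurable_cst.
    by apply: bounded_measurableD => //; exact: bounded_measurable_comp.
  move=> L; pose d := x - y; pose u := unit_vector L.
  have w1 := le_width r0 Kr (normal L) Kx Ky.
  have w2 := le_width r0 Kr (normal (rot L)) Kx Ky.
  apply: (@le_trans _ _ (`|dot (normal L) d| + `|dot (normal (rot L)) d|)); last exact: lerD.
  have -> : `|dot (normal (rot L)) d| = `|dot u d|.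
    have [e0 e1] := mulmx_rotation_matrix 0 1 u.
    have [E|E] := unit_vector_rotate L (rotation_matrixP cs);
      rewrite /normal dotE perpE0 perpE1 E ?rowNE e0 e1 [dot u d]dotE;
      rewrite -/u; [rewrite -normrN|]; congr `|_|; ring.
  have := normr_ge0 (dot (normal L) d); have := normr_ge0 (dot u d).
  set A := `|dot u d|; set B := `|dot (normal L) d| => A0 B0.
  rewrite -[leRHS]ger0_norm ?addr_ge0// -sqrtr_sqr ler_wsqrtr//.
  have uu : dot u u = 1 by have [] := unit_vectorP L.
  have -> : dot d d = A ^+ 2 + B ^+ 2.
    rewrite !real_normK ?num_real// -[LHS]mul1r -{1}uu.
    by rewrite !dotE perpE0 perpE1 -/u; ring.
  by rewrite sqrrD; nra.
rewrite Rintegral_bmD//; last exact: bounded_measurable_comp.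
rewrite Rintegral_probability_cst (Rintegral_invariant mrot (Pinv _ _ cs) bW).
by move=> /(lt_le_trans d0); lra.
Qed.

(** Both sides are quadratic in the weight, so the factor 3/16 cancels and the certificates for
    kappa = 1/3 (i = j) and kappa = 0 apply. *)
Lemma Rintegral_line_weight_lt (nu P : probability (linear_line R) R) i j :
  rotation_invariant nu -> rotation_invariant P ->
  \int[nu]_L `|line_weight i j L| *
    \int[P]_L (`|line_weight i j L| * line_width K L) <
  \int[P]_L (line_weight i j L ^+ 2 * line_width K L).
Proof.
move=> hnu hP; have bW := bounded_measurable_line_width r0 K0 Kr.
have W0 := Rintegral_line_width_gt0 hP.
have rotN c s L : c ^+ 2 + s ^+ 2 = 1 -> axis i j (rotate_line
    (rotation_matrix c s) (rotate_line (rotation_matrix c (- s)) L)) = axis i j L.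
  by move=> cs; rewrite -tr_rotation_matrix rotate_line_trK//; exact: rotation_matrixP.
pose h L := axis i j L + shift i j.
have key : \int[nu]_L `|h L| * \int[P]_L (`|h L| * line_width K L) <
    \int[P]_L (h L ^+ 2 * line_width K L).
  have core := @Rintegral_norm_lt _ _ R
    (fun c s => rotate_line (rotation_matrix c s)) (axis i j) (coaxis i j)
    (fun c s cs => rotate_line_measurable (rotation_matrixP cs))
    (@axis_measurable i j) (@axis_coaxis i j) (@axis_rotate i j) rotN
    (line_width K) P bW (line_width_rotate_ge r0 K0 Kr)
    (rotation_rho_invariant hP) nu.
  have e0 : 0 < 1 / (100 * 100) :> R by rewrite divr_gt0.
  rewrite /h /shift; case: eqP => _.
    apply: (core (1 / 3) 11 (pcoef3 R) _ (rotation_rho_invariant hnu) isT e0 W0).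
    - exact: (line_width_ge0 r0 K0 Kr).
    - exact: cert3_upper.
    - exact: cert3_width.
  apply: (core 0 5 (pcoef0 R) _ (rotation_rho_invariant hnu) isT e0 W0).
  - exact: (line_width_ge0 r0 K0 Kr).
  - exact: cert0_upper.
  - exact: cert0_width.
have bh : bounded_measurable h.
  apply: bounded_measurableD; last exact: bounded_measurable_cst.
  split; first exact: axis_measurable.
  exists 1 => L; have := axis_coaxis i j L; have := sqr_ge0 (coaxis i j L).
  set z := axis _ _ _; set w := coaxis _ _ _ => w0 zw.
  by rewrite ler_norml; apply/andP; split; nra.
have bnh := bounded_measurable_norm bh.
have bh2 : bounded_measurable (fun L => h L ^+ 2) by exact: bounded_measurableM.
have [k k0 gE] : exists2 k : R, 0 < k & forall L, line_weight i j L = k * h L.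
  by exists (3 / 16); [rewrite divr_gt0|move=> L; exact: line_weight_axis].
under eq_Rintegral do rewrite gE normrM (gtr0_norm k0).
under [X in _ * X < _]eq_Rintegral do rewrite gE normrM (gtr0_norm k0) -mulrA.
under [X in _ < X]eq_Rintegral do rewrite gE exprMn -mulrA.
rewrite !Rintegral_bmZ//; try exact: bounded_measurableM.
by rewrite mulrACA -expr2 ltr_pM2l// exprn_gt0.
Qed.

End line_weight_inequality.

(** * The kinematic formula *)

(** A and B are the support values bounding the slab, p is the offset of a line and b the rate at
    which translation along an axis changes it; t is the translation parameter. *)
Definition slab_indicator (R : realType) (A B p b t : R) : R :=
  if (- A <= p + t * b) && (p + t * b <= B) then 1 else 0.

Lemma slab_indicator_ge0 (R : realType) (A B p b t : R) :
  0 <= slab_indicator A B p b t.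
Proof. by rewrite /slab_indicator; case: ifP. Qed.

Lemma slab_indicator_reflect (R : realType) (A B p b t : R) :
  slab_indicator A B p b (- t) = slab_indicator B A (- p) b t.
Proof.
rewrite /slab_indicator; congr (if _ then _ else _).
have -> : p + - t * b = - (- p + t * b) by ring.
by rewrite lerN2 andbC; congr (_ && _); rewrite lerNl.
Qed.

Lemma integral_slab_indicator (R : realType) (A B p b : R) : 0 < b -> 0 <= A + B ->
  (\int[lebesgue_measure]_t (slab_indicator A B p b t)%:E = ((A + B) / b)%:E)%E.
Proof.
move=> b0 AB; pose I := [set` `[(- A - p) / b, (B - p) / b]].
transitivity (\int[@lebesgue_measure R]_t (\1_I t)%:E)%E.
  apply: eq_integral => t _; rewrite /slab_indicator indicE; congr (_%:E).
  have -> : (t \in I) = (- A <= p + t * b) && (p + t * b <= B).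
    rewrite /I mem_setE in_itv/= ler_pdivrMr// ler_pdivlMr//.
    by rewrite lerBlDl lerBrDl.
  by case: ifP.
rewrite (integral_indic _ measurableT); last exact: measurable_itv.
transitivity (lebesgue_measure I); first by rewrite setIT.
rewrite /I lebesgue_measure_itv/= lte_fin.
have -> : ((- A - p) / b < (B - p) / b) = (0 < A + B).
  rewrite ltr_pM2r ?invr_gt0// ltrD2r -subr_gt0 opprK addrC //.
case: ltP => AB0.
  by rewrite -EFinB; congr (_%:E); rewrite -mulrBl; congr (_ / _); ring.
have -> : A + B = 0 by apply/eqP; rewrite eq_le AB AB0.
by rewrite mul0r.
Qed.

Lemma slab_indicator_measurable d (T : measurableType d) (R : realType)
    (A B p b t : T -> R) : measurable_fun setT A -> measurable_fun setT B ->
  measurable_fun setT p -> measurable_fun setT b -> measurable_fun setT t ->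
  measurable_fun setT (fun x => slab_indicator (A x) (B x) (p x) (b x) (t x)).
Proof.
move=> mA mB mp mb mt.
have mptb : measurable_fun setT (fun x => p x + t x * b x).
  by apply: measurable_funD => //; exact: measurable_funM.
apply: measurable_fun_ifT; try exact: measurable_cst.
apply: measurable_and; apply: measurable_fun_ler => //.
exact: measurable_funN.
Qed.

(** * Translations of lines along the coordinate axes *)

Section line_translation.
Variable R : realType.
Implicit Types (E : affine_line R) (K : set 'rV[R]_2) (a : 'I_2).

Lemma is_rotation1 : is_rotation (1%:M : 'M[R]_2).
Proof. by split; rewrite ?trmx1 ?mulmx1 ?det1. Qed.

Definition translate_line (v : 'rV[R]_2) := move_line 1%:M v.

Lemma direction_translate v E : direction (translate_line v E) = direction E.
Proof.
have [x [w w0 Ew]] := affine_lineP E; apply: linear_line_inj.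
rewrite (direction_line _ (move_lineE v is_rotation1 w0 Ew)) ?mulmx1//.
by rewrite (direction_line w0 Ew).
Qed.

Lemma offset_translate a E t :
  offset a (translate_line (t *: delta_mx 0 a) E) =
  offset a E + t * normal (direction E) 0 a ^+ 2.
Proof.
have : affine_line_set (translate_line (t *: delta_mx 0 a) E)
    (line_point E + t *: delta_mx 0 a).
  rewrite /translate_line move_line_image; last exact: is_rotation1.
  by exists (line_point E); [exact: line_point_mem|rewrite mulmx1].
move=> /offset_mem ->; rewrite direction_translate !dot_conormal.
rewrite /offset dot_conormal.
have -> : normal (direction E) 0 a ^+ 2 = normal (direction E) 0 a *
    dot (normal (direction E)) (delta_mx 0 a).
  rewrite expr2 dotE !mxE /=; congr (_ * _).
  by case: a => [[|[|//]] ?] /=; rewrite mulr1 mulr0 ?addr0 ?add0r.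
by rewrite !dotE !mxE; ring.
Qed.

Section hitting_indicator.
Variables (K : set 'rV[R]_2) (r : R).
Hypotheses (r0 : 0 < r) (K0 : K !=set0) (Kr : K `<=` disc r) (hK : convex_body K).

Lemma hitting_slab_indicator a E : normal (direction E) 0 a != 0 ->
  \1_(hitting K) E = slab_indicator (support K (-1 *: conormal a (direction E)))
    (support K (1 *: conormal a (direction E))) (offset a E)
    (normal (direction E) 0 a ^+ 2) 0.
Proof.
move=> na; rewrite /slab_indicator mul0r addr0 indicE.
case: (boolP (_ && _)) => [/(hitting_slab r0 K0 Kr hK na) hE|/negP hE].
  by rewrite mem_set.
by rewrite memNset// => /(hitting_slab r0 K0 Kr hK na).
Qed.

Lemma hitting_disc_slab_indicator a E : normal (direction E) 0 a != 0 ->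
  \1_(hitting (disc r)) E = slab_indicator (r * `|normal (direction E) 0 a|)
    (r * `|normal (direction E) 0 a|) (offset a E)
    (normal (direction E) 0 a ^+ 2) 0.
Proof.
move=> na; rewrite /slab_indicator mul0r addr0 indicE.
case: (boolP (_ && _)) => [/(hitting_disc_slab r0 na) hE|/negP hE].
  by rewrite mem_set.
by rewrite memNset// => /(hitting_disc_slab r0 na).
Qed.

Lemma normal_sqr_measurable a :
  measurable_fun setT (fun L : linear_line R => normal L 0 a ^+ 2).
Proof. by under eq_fun do rewrite expr2; exact: normal_prod_measurable. Qed.

(** The two coordinates of a unit normal do not vanish together, so the two charts in which slabs
    describe hitting cover all lines. *)
Lemma measurable_hitting_of_slabs (H : set (affine_line R)) :
  (forall a, measurable [set E | normal (direction E) 0 a != 0 /\ H E]) ->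
  measurable H.
Proof.
move=> mH; rewrite (_ : H = [set E | normal (direction E) 0 0 != 0 /\ H E] `|`
    [set E | normal (direction E) 0 1 != 0 /\ H E]).
  exact: measurableU.
apply/seteqP; split=> E /=; last by case=> -[].
move=> HE; have [n0|n0] := eqVneq (normal (direction E) 0 0) 0; last by left.
right; split => //; apply/eqP => n1; have := normal_sqrD (direction E).
by rewrite n0 n1 expr0n addr0 => /eqP; rewrite eq_sym oner_eq0.
Qed.

End hitting_indicator.
End line_translation.

Lemma measurable_true d (T : measurableType d) (b : T -> bool) :
  measurable_fun setT b -> measurable [set x | b x].
Proof.
move=> mb; have := mb measurableT [set true] I; rewrite setTI.
by congr measurable; apply/seteqP; split=> x /=; case: (b x).
Qed.

Lemma ge0_integral_mrestr d (T : measurableType d) (R : realType)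
    (mu : {measure set T -> \bar R}) (H : set T) (mH : measurable H)
    (g : T -> \bar R) : measurable_fun setT g -> (forall x, (0 <= g x)%E) ->
  (\int[mrestr mu mH]_x g x = \int[mu]_x ((\1_H x)%:E * g x))%E.
Proof.
move=> mg g0; have mHC : measurable (~` H) by exact: measurableC.
transitivity (\int[mrestr mu mH]_(x in H) g x)%E.
  rewrite -{1}(setUv H) ge0_integral_setU//=; last 2 first.
  - by rewrite setUv.
  - by apply/disj_setPS; rewrite setICr.
  rewrite [X in (_ + X)%E](null_set_integral mHC) ?adde0//.
  - exact: measurable_funTS.
  - transitivity (mu (~` H `&` H)); first by [].
    by rewrite setICl measure0.
transitivity (\int[mu]_(x in H) g x)%E.
  apply: eq_measure_integral => A mA AH.
  by transitivity (mu (A `&` H)); [|rewrite setIidl].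
rewrite integral_mkcond; apply: eq_integral => x _; rewrite patchE indicE.
by case: ifP; rewrite ?mul1e ?mul0e.
Qed.

(** * Hitting probabilities as integrals of the width *)

Section kinematic_formula.
Context d (T : measurableType d) (R : realType).
Variables (mu : {measure set (affine_line R) -> \bar R}) (r : R).
Variables (P : probability T R) (X : T -> affine_line R).
Hypotheses (hmu : motion_invariant mu) (r0 : 0 < r) (hX : IUR_line mu r P X).
Implicit Types (E : affine_line R) (a : 'I_2).

Let mX : measurable_fun setT X. Proof. by case: hX. Qed.

Lemma normr_normal_direction_measurable a :
  measurable_fun setT (fun E => `|normal (direction E) 0 a|).
Proof. exact: (measurableT_comp (normr_normal_measurable a) (@direction_measurable R)). Qed.

Lemma hitting_disc_measurable : measurable (hitting (disc r)).
Proof.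
apply: measurable_hitting_of_slabs => a.
pose b E := (0 < `|normal (direction E) 0 a|) &&
  ((- (r * `|normal (direction E) 0 a|) <= offset a E) &&
   (offset a E <= r * `|normal (direction E) 0 a|)).
have mn := normr_normal_direction_measurable a.
have mrn : measurable_fun setT (fun E => r * `|normal (direction E) 0 a|).
  by apply: measurable_funM => //; exact: measurable_cst.
have mb : measurable_fun setT b.
  apply: measurable_and; first by apply: measurable_fun_ltr => //; exact: measurable_cst.
  apply: measurable_and; apply: measurable_fun_ler => //; try exact: offset_measurable.
  exact: measurable_funN.
have := measurable_true mb; congr measurable; apply/seteqP; split=> E /=.
  move=> /andP[n0 s]; have na : normal (direction E) 0 a != 0 by rewrite -normr_gt0.
  by split => //; apply/(hitting_disc_slab r0 na).
move=> [na /(hitting_disc_slab r0 na) hE]; rewrite /b normr_gt0 na.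
exact: hE.
Qed.

Lemma IUR_lawE A : measurable A ->
  P (X @^-1` A) = ((2 * r)^-1%:E * mu (A `&` hitting (disc r)))%E.
Proof.
move=> mA; have [_ ->//] := hX; congr (_ * _)%E.
under eq_integral do rewrite mulr1.
by rewrite integral_indic//; [rewrite setIC|exact: hitting_disc_measurable].
Qed.

Lemma ge0_integral_IUR (g : affine_line R -> \bar R) :
  measurable_fun setT g -> (forall E, (0 <= g E)%E) ->
  (\int[P]_w g (X w) = (2 * r)^-1%:E *
    \int[mu]_E ((\1_(hitting (disc r)) E)%:E * g E))%E.
Proof.
move=> mg g0; have r2 : 0 <= (2 * r)^-1 by rewrite invr_ge0 mulr_ge0// ltW.
rewrite -(ge0_integral_mrestr mu hitting_disc_measurable mg g0).
transitivity (\int[pushforward P X]_E g E)%E.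
  by rewrite (ge0_integral_pushforward mX _ measurableT)// preimage_setT.
pose k := NngNum r2.
rewrite -(@ge0_integral_mscale _ _ _ _ _ measurableT k)//.
apply: eq_measure_integral => A mA _.
exact: IUR_lawE.
Qed.

Lemma ge0_integral_translate (v : 'rV[R]_2) (g : affine_line R -> \bar R) :
  measurable_fun setT g -> (forall E, (0 <= g E)%E) ->
  (\int[mu]_E g (translate_line v E) = \int[mu]_E g E)%E.
Proof.
move=> mg g0; have rot1 := @is_rotation1 R.
have mt : measurable_fun setT (translate_line v) by exact: move_line_measurable.
transitivity (\int[pushforward mu (translate_line v)]_E g E)%E.
  by rewrite (ge0_integral_pushforward mt _ measurableT)// preimage_setT.
apply: eq_measure_integral => A mA _; exact: (motion_invariantP v hmu rot1 mA).
Qed.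

Variable K : set 'rV[R]_2.
Hypotheses (K0 : K !=set0) (Kr : K `<=` disc r) (hK : convex_body K).

Lemma hitting_measurable : measurable (hitting K).
Proof.
apply: measurable_hitting_of_slabs => a.
have msup (s : R) : measurable_fun setT
    (fun E => support K (s *: conormal a (direction E))).
  apply: (measurableT_comp (support_conormal_measurable a s r0 K0 Kr)).
  exact: direction_measurable.
pose b E := (0 < `|normal (direction E) 0 a|) &&
  ((- support K (-1 *: conormal a (direction E)) <= offset a E) &&
   (offset a E <= support K (1 *: conormal a (direction E)))).
have mb : measurable_fun setT b.
  apply: measurable_and.
    by apply: measurable_fun_ltr; [exact: measurable_cst|exact: normr_normal_direction_measurable].
  apply: measurable_and; apply: measurable_fun_ler; try exact: offset_measurable.
    exact: measurable_funN.
  exact: msup.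
have := measurable_true mb; congr measurable; apply/seteqP; split=> E /=.
  move=> /andP[n0 s]; have na : normal (direction E) 0 a != 0 by rewrite -normr_gt0.
  by split => //; apply/(hitting_slab r0 K0 Kr hK na).
move=> [na /(hitting_slab r0 K0 Kr hK na) hE]; rewrite /b normr_gt0 na.
exact: hE.
Qed.

Lemma hitting_subset_disc E : hitting K E -> hitting (disc r) E.
Proof. by move=> [x [Ex Kx]]; exists x; split => //; exact: Kr. Qed.

(** A double count of lines and translations t along the axis. For a line E hitting K, the t for
    which the translated line hits the disc have length 2 r |n_a| / n_a^2; for arbitrary E, the t
    for which E translated by -t hits K have length |n_a| W / n_a^2. Translation invariance of [mu]
    matches the two counts for each t, and Tonelli integrates over t. *)
Lemma slab_exchange a (q : linear_line R -> R) :
  measurable_fun setT q -> (forall L, 0 <= q L) ->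
  (\int[P]_w (q (direction (X w)) * \1_(hitting K) (X w) *
      (2 * r * `|normal (direction (X w)) 0 a|))%:E =
   \int[P]_w (q (direction (X w)) * width K (conormal a (direction (X w))))%:E)%E.
Proof.
move=> mq q0.
pose n E := `|normal (direction E) 0 a|; pose b E := normal (direction E) 0 a ^+ 2.
pose A E := support K (-1 *: conormal a (direction E)).
pose B E := support K (1 *: conormal a (direction E)).
have AB E : A E + B E = width K (conormal a (direction E)).
  by rewrite /A /B /width scale1r scaleN1r addrC.
have AB0 E : 0 <= A E + B E.
  by rewrite AB (width_conormal r0 K0 Kr)// mulr_ge0// (line_width_ge0 r0 K0 Kr).
have mn : measurable_fun setT n := @normr_normal_direction_measurable a.
have mb : measurable_fun setT b.
  exact: (measurableT_comp (normal_sqr_measurable a) (@direction_measurable R)).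
have msup (s : R) : measurable_fun setT
    (fun E => support K (s *: conormal a (direction E))).
  apply: (measurableT_comp (support_conormal_measurable a s r0 K0 Kr)).
  exact: direction_measurable.
have mqd : measurable_fun setT (fun E => q (direction E)).
  exact: (measurableT_comp mq (@direction_measurable R)).
have mhit : measurable_fun setT (\1_(hitting K) : affine_line R -> R).
  exact: measurable_indic hitting_measurable.
(* The factor b = n_a^2 cancels the denominators of these lengths and makes both integrands vanish
   on lines parallel to the axis, where the sets of t may be unbounded. *)
pose F1 t E := q (direction E) * b E * \1_(hitting K) E *
  slab_indicator (r * n E) (r * n E) (offset a E) (b E) t.
pose F2 t E := q (direction E) * b E *
  slab_indicator (A E) (B E) (offset a E) (b E) (- t).
have qb0 E : 0 <= q (direction E) * b E by rewrite mulr_ge0// sqr_ge0.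
have qbh0 E : 0 <= q (direction E) * b E * \1_(hitting K) E.
  by rewrite mulr_ge0// indicE.
have F10 t E : 0 <= F1 t E by rewrite mulr_ge0// slab_indicator_ge0.
have F20 t E : 0 <= F2 t E by rewrite mulr_ge0// slab_indicator_ge0.
have mF1 d' (S : measurableType d') (t : S -> R) (E : S -> affine_line R) :
    measurable_fun setT t -> measurable_fun setT E ->
    measurable_fun setT (fun x => F1 (t x) (E x)).
  move=> mt mE; apply: measurable_funM; last first.
    have mrn : measurable_fun setT (fun x => r * n (E x)).
      by apply: measurable_funM; [exact: measurable_cst|exact: measurableT_comp].
    apply: slab_indicator_measurable => //; last exact: measurableT_comp.
    by apply: measurableT_comp mE; exact: offset_measurable.
  apply: measurable_funM; last exact: measurableT_comp.
  exact: measurable_funM (measurableT_comp mqd mE) (measurableT_comp mb mE).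
have mF2 d' (S : measurableType d') (t : S -> R) (E : S -> affine_line R) :
    measurable_fun setT t -> measurable_fun setT E ->
    measurable_fun setT (fun x => F2 (t x) (E x)).
  move=> mt mE; apply: measurable_funM; last first.
    apply: slab_indicator_measurable; try exact: measurableT_comp.
    - by apply: measurableT_comp mE; exact: msup.
    - by apply: measurableT_comp mE; exact: msup.
    - by apply: measurableT_comp mE; exact: offset_measurable.
  exact: measurable_funM (measurableT_comp mqd mE) (measurableT_comp mb mE).
have exchange t : (\int[P]_w (F1 t (X w))%:E = \int[P]_w (F2 t (X w))%:E)%E.
  have mG (F : R -> affine_line R -> R) : measurable_fun setT (F t) ->
    measurable_fun setT (fun E => (\1_(hitting (disc r)) E)%:E * (F t E)%:E)%E.
    move=> mF; under eq_fun do rewrite -EFinM.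
    apply/measurable_EFinP; apply: measurable_funM => //.
    exact: measurable_indic hitting_disc_measurable.
  have mF1t : measurable_fun setT (F1 t) by exact: (mF1 _ _ (fun=> t) id (measurable_cst _) (@measurable_id _ _ _)).
  have mF2t : measurable_fun setT (F2 t) by exact: (mF2 _ _ (fun=> t) id (measurable_cst _) (@measurable_id _ _ _)).
  have mE1 : measurable_fun setT (fun E => (F1 t E)%:E) by exact/measurable_EFinP.
  have ge1 E : (0 <= (F1 t E)%:E)%E by rewrite lee_fin.
  rewrite (ge0_integral_IUR mE1 ge1).
  have mE2 : measurable_fun setT (fun E => (F2 t E)%:E) by exact/measurable_EFinP.
  have ge2 E : (0 <= (F2 t E)%:E)%E by rewrite lee_fin.
  rewrite (ge0_integral_IUR mE2 ge2).
  congr (_ * _)%E; rewrite -[RHS](ge0_integral_translate (t *: delta_mx 0 a)); last 2 first.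
  - exact: mG.
  - by move=> E; rewrite -EFinM lee_fin mulr_ge0.
  apply: eq_integral => E _; rewrite -!EFinM; congr (_%:E).
  rewrite /F1 /F2 /n /b /A /B direction_translate.
  have [n0|n0] := eqVneq (normal (direction E) 0 a) 0.
    by rewrite n0 expr0n/= !(mulr0, mul0r).
  have -> : \1_(hitting (disc r)) (translate_line (t *: delta_mx 0 a) E) =
      slab_indicator (r * `|normal (direction E) 0 a|)
      (r * `|normal (direction E) 0 a|) (offset a E)
      (normal (direction E) 0 a ^+ 2) t.
    have nt0 : normal (direction (translate_line (t *: delta_mx 0 a) E)) 0 a != 0.
      by rewrite direction_translate.
    rewrite (hitting_disc_slab_indicator r0 nt0) direction_translate offset_translate.
    by rewrite /slab_indicator mul0r addr0.
  rewrite offset_translate.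
  have -> : slab_indicator (support K (-1 *: conormal a (direction E)))
      (support K (1 *: conormal a (direction E)))
      (offset a E + t * normal (direction E) 0 a ^+ 2)
      (normal (direction E) 0 a ^+ 2) (- t) = \1_(hitting K) E.
    rewrite (hitting_slab_indicator r0 K0 Kr hK n0) /slab_indicator mul0r addr0.
    by rewrite mulNr addrK.
  (* Before translation a line counted by [F1] hits K and hence the disc, so the disc indicator of
     the IUR law is redundant there; the one of the translated line occurs on both sides. *)
  have hKD : \1_(hitting (disc r)) E * \1_(hitting K) E = \1_(hitting K) E :> R.
    rewrite !indicE; case: (boolP (E \in hitting K)) => [|_]; last by rewrite mulr0.
    by rewrite inE => /hitting_subset_disc hE; rewrite mem_set// mulr1.
  set S := slab_indicator _ _ _ _ t; set h := \1_(hitting (disc r)) E in hKD *.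
  transitivity (q (direction E) * normal (direction E) 0 a ^+ 2 * S *
    (h * \1_(hitting K) E)); first by ring.
  by rewrite hKD; ring.
transitivity (\int[P]_w \int[lebesgue_measure]_t (F1 t (X w))%:E)%E.
  apply: eq_integral => w _; rewrite /F1; set E := X w.
  have [n0|n0] := eqVneq (normal (direction E) 0 a) 0.
    rewrite n0 normr0 !mulr0; apply/esym; apply: integral0_eq => t _.
    by rewrite /b n0 expr0n/= !(mulr0, mul0r).
  have b0 : 0 < b E by rewrite exprn_even_gt0.
  under [RHS]eq_integral do rewrite EFinM.
  rewrite ge0_integralZl//; last 3 first.
  - apply/measurable_EFinP; apply: slab_indicator_measurable; try exact: measurable_cst.
    exact: measurable_id.
  - by move=> t _; rewrite lee_fin slab_indicator_ge0.
  - by rewrite lee_fin; exact: qbh0.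
  have rn0 : 0 <= r * n E by rewrite mulr_ge0 ?(ltW r0) ?normr_ge0.
  rewrite integral_slab_indicator//; last exact: addr_ge0.
  rewrite -EFinM; congr (_%:E); rewrite -/(n E) -mulr2n.
  have -> : b E = n E ^+ 2 by rewrite /b /n real_normK ?num_real.
  by rewrite mulr2n; field; rewrite normr_eq0.
transitivity (\int[P]_w \int[lebesgue_measure]_t (F2 t (X w))%:E)%E; last first.
  apply: eq_integral => w _; rewrite /F2; set E := X w.
  have [n0|n0] := eqVneq (normal (direction E) 0 a) 0.
    rewrite (width_conormal r0 K0 Kr) n0 normr0 mul0r mulr0.
    by apply: integral0_eq => t _; rewrite /b n0 expr0n/= !(mulr0, mul0r).
  have b0 : 0 < b E by rewrite exprn_even_gt0.
  under eq_integral do rewrite slab_indicator_reflect EFinM.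
  rewrite ge0_integralZl//; last 3 first.
  - apply/measurable_EFinP; apply: slab_indicator_measurable; try exact: measurable_cst.
    exact: measurable_id.
  - by move=> t _; rewrite lee_fin slab_indicator_ge0.
  - by rewrite lee_fin; exact: qb0.
  rewrite integral_slab_indicator//; last by rewrite addrC.
  rewrite -EFinM -AB; congr (_%:E).
  by field; rewrite gt_eqF.
have mF1z : measurable_fun setT (fun z : T * R => (F1 z.2 (X z.1))%:E).
  by apply/measurable_EFinP; apply: mF1 => //; exact: measurableT_comp.
have mF2z : measurable_fun setT (fun z : T * R => (F2 z.2 (X z.1))%:E).
  by apply/measurable_EFinP; apply: mF2 => //; exact: measurableT_comp.
have F1z z : (0 <= (F1 z.2 (X z.1))%:E)%E by rewrite lee_fin.
have F2z z : (0 <= (F2 z.2 (X z.1))%:E)%E by rewrite lee_fin.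
rewrite (@fubini_tonelli _ _ _ _ R P lebesgue_measure _ mF1z F1z).
rewrite (@fubini_tonelli _ _ _ _ R P lebesgue_measure _ mF2z F2z).
by apply: eq_integral => t _; exact: exchange.
Qed.

(* [slab_exchange] holds trivially for lines parallel to the chosen axis;
   weighting both axes by the squared coordinates of the normal, which sum to
   one, covers all directions. *)
Lemma kinematic_formula (q : linear_line R -> R) : bounded_measurable q ->
  (forall L, 0 <= q L) ->
  2 * r * \int[P]_w (q (direction (X w)) * \1_(hitting K) (X w)) =
  \int[P]_w (q (direction (X w)) * line_width K (direction (X w))).
Proof.
move=> bq q0; have [mq _] := bq.
have mdX : measurable_fun setT (fun w => direction (X w)).
  exact: (measurableT_comp (@direction_measurable R) mX).
have bn a : bounded_measurable (fun L : linear_line R => `|normal L 0 a|).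
  split; first exact: normr_normal_measurable.
  exists 1 => L; rewrite normr_id; have := normal_sqrD L.
  rewrite -(@expr_le1 _ 2)// real_normK ?num_real//.
  have := sqr_ge0 (normal L 0 0); have := sqr_ge0 (normal L 0 1).
  by case: a => [[|[|//]] ak]; [have -> : Ordinal ak = 0 by exact: val_inj|
    have -> : Ordinal ak = 1 by exact: val_inj]; lra.
have bqX : bounded_measurable (fun w => q (direction (X w))).
  exact: bounded_measurable_comp.
have bnX a : bounded_measurable (fun w => `|normal (direction (X w)) 0 a|).
  exact: (bounded_measurable_comp mdX (bn a)).
have bh : bounded_measurable (fun w => \1_(hitting K) (X w) : R).
  apply: bounded_measurable_comp => //; split.
    exact: measurable_indic hitting_measurable.
  by exists 1 => E; rewrite indicE ger0_norm// lern1 leq_b1.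
have bn2 a : bounded_measurable (fun w => `|normal (direction (X w)) 0 a| ^+ 2).
  exact: (bounded_measurableM (bnX a) (bnX a)).
have bW : bounded_measurable (fun w => line_width K (direction (X w))).
  exact: (bounded_measurable_comp mdX (bounded_measurable_line_width r0 K0 Kr)).
have coord a : 2 * r * \int[P]_w (`|normal (direction (X w)) 0 a| ^+ 2 *
      (q (direction (X w)) * \1_(hitting K) (X w))) =
    \int[P]_w (`|normal (direction (X w)) 0 a| ^+ 2 *
      (q (direction (X w)) * line_width K (direction (X w)))).
  (* Applied to q |n_a|, the exchange formula carries n_a^2 on both sides. *)
  have mqn : measurable_fun setT (fun L => q L * `|normal L 0 a|).
    by apply: measurable_funM => //; exact: normr_normal_measurable.
  have qn0 L : 0 <= q L * `|normal L 0 a| by rewrite mulr_ge0.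
  have /(congr1 fine) := slab_exchange a mqn qn0.
  rewrite -!/(Rintegral _ _ _) => E.
  rewrite -Rintegral_bmZ; last first.
    by apply: bounded_measurableM => //; exact: bounded_measurableM.
  transitivity (\int[P]_w (q (direction (X w)) * `|normal (direction (X w)) 0 a| *
      \1_(hitting K) (X w) * (2 * r * `|normal (direction (X w)) 0 a|))).
    by apply: eq_Rintegral => w _; ring.
  rewrite E; apply: eq_Rintegral => w _; rewrite (width_conormal r0 K0 Kr); ring.
have split_normal (V : T -> R) : bounded_measurable V -> \int[P]_w V w =
    \int[P]_w (`|normal (direction (X w)) 0 0| ^+ 2 * V w) +
    \int[P]_w (`|normal (direction (X w)) 0 1| ^+ 2 * V w).
  move=> bV; rewrite -Rintegral_bmD; try exact: bounded_measurableM.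
  apply: eq_Rintegral => w _; rewrite -mulrDl !real_normK ?num_real//.
  by rewrite normal_sqrD mul1r.
rewrite [in LHS]split_normal; last exact: bounded_measurableM.
rewrite [RHS]split_normal; last exact: bounded_measurableM.
by rewrite mulrDr !coord.
Qed.

End kinematic_formula.

(** * Laws of random lines *)

Section bounded_random_variables.
Context d (T : measurableType d) (R : realType) (P : probability T R).

Lemma expectation_bounded_measurable (F : T -> R) : bounded_measurable F ->
  ('E_P[F] = (\int[P]_x F x)%:E)%E.
Proof.
move=> bF; rewrite unlock /Rintegral fineK//.
by apply: integrable_fin_num => //; exact: bounded_measurable_integrable.
Qed.

Lemma variance_bounded_measurable (F : T -> R) : bounded_measurable F ->
  ('V_P[F] = (\int[P]_x (F x * F x) - (\int[P]_x F x) ^+ 2)%:E)%E.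
Proof.
move=> bF; have bFF : bounded_measurable (F * F) := bounded_measurableM bF bF.
have L1 G : bounded_measurable G -> G \in Lfun P 1.
  by move=> bG; apply/Lfun1_integrable; exact: bounded_measurable_integrable.
rewrite /variance covarianceE; [|exact: L1|exact: L1|exact: (L1 _ bFF)].
rewrite (expectation_bounded_measurable bF) (expectation_bounded_measurable bFF).
by rewrite -EFinM -EFinB -expr2.
Qed.

Lemma Rintegral_indic_comp d' (T' : measurableType d') (E : T -> T') (A : set T') :
  measurable_fun setT E -> measurable A ->
  \int[P]_x \1_A (E x) = fine (P (E @^-1` A)).
Proof.
move=> mE mA; congr fine; transitivity (\int[P]_x (\1_(E @^-1` A) x)%:E)%E.
  by [].
have mEA : measurable (E @^-1` A) by rewrite -[X in measurable X]setTI; exact: mE.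
by rewrite integral_indic// setIT.
Qed.

Lemma bounded_measurable_indic (A : set T) : measurable A ->
  bounded_measurable (\1_A : T -> R).
Proof.
move=> mA; split; first exact: measurable_indic.
by exists 1 => x; rewrite indicE ger0_norm// lern1 leq_b1.
Qed.

End bounded_random_variables.

Section line_laws.
Variable R : realType.
Variables (mu : {measure set (affine_line R) -> \bar R}) (r : R).
Hypotheses (hmu : motion_invariant mu) (r0 : 0 < r).
Context d (T : measurableType d) (P : probability T R) (X : T -> affine_line R).
Hypothesis hX : IUR_line mu r P X.

Let mX : measurable_fun setT X. Proof. by case: hX. Qed.

Lemma direction_rv_measurable : measurable_fun setT (fun w => direction (X w)).
Proof. exact: (measurableT_comp (@direction_measurable R) mX). Qed.

Lemma hitting_disc_rotate (Q : 'M[R]_2) E : is_rotation Q ->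
  hitting (disc r) (move_line Q 0 E) <-> hitting (disc r) E.
Proof.
move=> rQ; rewrite /hitting /= move_line_image//; split.
  move=> [_ [[x Ex <-]]]; rewrite addr0 => /(discP _ r0); rewrite is_rotationP// => Dx.
  by exists x; split => //; apply/(discP _ r0).
move=> [x [Ex /(discP _ r0) Dx]]; exists (x *m Q + 0); split; first by exists x.
by apply/(discP _ r0); rewrite addr0 is_rotationP.
Qed.

(** A rotation about the origin preserves [mu] and the set of lines hitting the disc, and it acts on
    directions by [rotate_line]. *)
Lemma IUR_direction_rotation (Q : 'M[R]_2) A : is_rotation Q -> measurable A ->
  P ((fun w => direction (X w)) @^-1` (rotate_line Q @^-1` A)) =
  P ((fun w => direction (X w)) @^-1` A).
Proof.
move=> rQ mA.
have mdA (B : set (linear_line R)) : measurable B -> measurable (@direction R @^-1` B).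
  by move=> mB; rewrite -[X in measurable X]setTI; exact: direction_measurable.
have mQA : measurable (rotate_line Q @^-1` A).
  by rewrite -[X in measurable X]setTI; exact: rotate_line_measurable.
have mH := hitting_disc_measurable r0 : measurable (hitting (disc r)).
transitivity (P (X @^-1` (@direction R @^-1` (rotate_line Q @^-1` A)))) => //.
rewrite (IUR_lawE r0 hX (mdA _ mQA)).
transitivity (P (X @^-1` (@direction R @^-1` A))) => //.
rewrite (IUR_lawE r0 hX (mdA _ mA)); congr (_ * _)%E.
rewrite -(motion_invariantP 0 hmu rQ (measurableI _ _ (mdA _ mA) mH)).
congr (mu _); apply/seteqP; split=> E /= [dE hE]; split.
- by rewrite direction_move_line.
- by apply/hitting_disc_rotate.
- by rewrite -(direction_move_line 0 _ rQ).
- by apply/(hitting_disc_rotate _ rQ).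
Qed.

Lemma IUR_direction_law : exists lam : probability (linear_line R) R,
  rotation_invariant lam /\ forall F : linear_line R -> R, bounded_measurable F ->
    \int[lam]_L F L = \int[P]_w F (direction (X w)).
Proof.
pose mixin := isMeasurableFun.Build _ _ _ _ _ direction_rv_measurable.
pose Y : {mfun T >-> linear_line R} := HB.pack (fun w => direction (X w)) mixin.
exists (distribution P Y); split.
  move=> Q rQ A mA; have rQt := is_rotation_tr rQ.
  (* The image under Q is the preimage under its transpose, which is its inverse. *)
  transitivity (P ((fun w => direction (X w)) @^-1` (rotate_line Q^T @^-1` A))).
    congr (P _); apply/seteqP; split=> w.
      move=> [L AL dX]; rewrite /preimage/mkset.
      have -> : direction (X w) = rotate_line Q L.
        by apply: linear_line_inj; rewrite rotate_line_image.
      by rewrite -{2}[Q]trmxK rotate_line_trK.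
    rewrite /preimage/mkset => AL; eexists; first exact: AL.
    by rewrite -rotate_line_image// rotate_line_trK.
  exact: IUR_direction_rotation.
move=> F bF; congr fine.
have [mF _] := bF.
rewrite (@integral_distribution _ _ _ _ _ P Y (EFin \o F)) //.
  exact/measurable_EFinP.
exact: (bounded_measurable_integrable P (bounded_measurable_comp direction_rv_measurable bF)).
Qed.

Context d1 (T1 : measurableType d1) (P1 : probability T1 R) (X1 : T1 -> affine_line R).

(** The law of the weighted line has density f(direction) with respect to the IUR law, so both sides
    of the theorem become integrals over one probability space. *)
Lemma weighted_lawE (f : linear_line R -> R) A :
  weighted_random_line mu r f P1 X1 -> measurable_fun setT f ->
  (forall L, 0 <= f L) -> measurable A ->
  fine (P1 (X1 @^-1` A)) = \int[P]_w (\1_A (X w) * f (direction (X w))).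
Proof.
move=> [mX1 lawX1] mf f0 mA; rewrite lawX1//; congr fine.
have mfd : measurable_fun setT (fun E => f (direction E)).
  exact: (measurableT_comp mf (@direction_measurable R)).
have mg : measurable_fun setT (fun E => (\1_A E * f (direction E))%:E).
  apply/measurable_EFinP; apply: measurable_funM => //; exact: measurable_indic.
have g0 E : (0 <= (\1_A E * f (direction E))%:E)%E.
  by rewrite lee_fin mulr_ge0// indicE.
rewrite (ge0_integral_IUR r0 hX mg g0); congr (_ * _)%E.
rewrite integral_mkcond; apply: eq_integral => E _.
rewrite patchE -EFinM indicE [in RHS]indicE.
by case: (E \in A); rewrite ?mul1r// mul0r mulr0.
Qed.

End line_laws.

(** Division by f compensates the weighting, so the means agree and only second moments are
    compared. The two distinct points of K exclude the case in which the width vanishes identically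
    and both variances are 0. *)
Theorem theorem4p10 (R : realType)
  (nu : probability (linear_line R) R) (hnu : rotation_invariant nu)
  (mu : {measure set (affine_line R) -> \bar R}) (hmu : motion_invariant mu)
  (hmu2 : mu (hitting (disc 1)) = 2%:E)
  (K : set 'rV[R]_2) (hK : convex_body K)
  (hK2 : exists x y, [/\ K x, K y & x != y])
  (r : R) (hr : 0 < r) (hKr : K `<=` disc r)
  (i j : 'I_2)
  (f : linear_line R -> R) (hf : is_density nu f)
  (hfg : exists c : R, forall L, f L = c * `|line_weight i j L|)
  (d1 : measure_display) (T1 : measurableType d1) (P1 : probability T1 R)
  (E1 : T1 -> affine_line R) (hE1 : weighted_random_line mu r f P1 E1)
  (d2 : measure_display) (T2 : measurableType d2) (P2 : probability T2 R)
  (E2 : T2 -> affine_line R) (hE2 : IUR_line mu r P2 E2) :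
  ('V_P1[fun t => (phi_hat r i j K (E1 t) / f (direction (E1 t)))%R]
    < 'V_P2[fun t => phi_hat r i j K (E2 t)])%E.
Proof.
have K0 : K !=set0 by have [x [y [Kx _ _]]] := hK2; exists x.
have [mf f0 intf] := hf; have [c fE] := hfg; have [mE1 _] := hE1; have [mE2 _] := hE2.
set g : linear_line R -> R := line_weight i j in fE.
have bg : bounded_measurable g := bounded_measurable_line_weight R i j.
have bng := bounded_measurable_norm bg.
have cm : c * \int[nu]_L `|g L| = 1.
  rewrite -Rintegral_bmZ// /Rintegral; transitivity (fine (\int[nu]_L (f L)%:E)%E).
    by congr fine; apply: eq_integral => L _; rewrite fE.
  by rewrite intf.
have c0 : 0 < c.
  rewrite ltNge; apply/negP => c0; have := @ltr01 R; rewrite -cm ltNge => /negP; apply.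
  by rewrite mulr_le0_ge0// Rintegral_ge0.
have [lam [hlam lamE]] := IUR_direction_law hmu hr hE2.
have mH := hitting_measurable hr K0 hKr hK.
have mdE2 := direction_rv_measurable hE2.
have bW := bounded_measurable_line_width hr K0 hKr.
have key := Rintegral_line_weight_lt hr hKr hK2 i j hnu hlam.
pose A1 := \int[P2]_w (`|g (direction (E2 w))| * \1_(hitting K) (E2 w)).
pose A2 := \int[P2]_w (g (direction (E2 w)) ^+ 2 * \1_(hitting K) (E2 w)).
have bg2 : bounded_measurable (fun L => g L ^+ 2) := bounded_measurableM bg bg.
(* The kinematic formula turns the width integrals into integrals over lines hitting K; the common
   factor 2 r cancels. *)
have A12 : (\int[nu]_L `|g L|) * A1 < A2.
  have kin1 := kinematic_formula hmu hr hE2 K0 hKr hK bng (fun L => normr_ge0 _).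
  have kin2 := kinematic_formula hmu hr hE2 K0 hKr hK bg2 (fun L => sqr_ge0 _).
  move: key; rewrite !lamE; try exact: bounded_measurableM.
  rewrite -kin1 -kin2 mulrCA ltr_pM2l//.
  by rewrite mulr_gt0.
have V0E (E : affine_line R) : V0 (K `&` E) = \1_(hitting K) E :> R.
  by rewrite /V0 setIC indicE; congr (nat_of_bool _)%:R; apply/asboolP/idP; rewrite inE.
have bh : bounded_measurable (fun w => \1_(hitting K) (E2 w) : R).
  exact: (bounded_measurable_comp mE2 (bounded_measurable_indic R mH)).
have bgd : bounded_measurable (fun w => g (direction (E2 w))).
  exact: (bounded_measurable_comp mdE2 bg).
pose F2 w := 2 * r * (g (direction (E2 w)) * \1_(hitting K) (E2 w)).
have bF2 : bounded_measurable F2.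
  by apply: bounded_measurableM; [exact: bounded_measurable_cst|exact: bounded_measurableM].
have -> : (fun t => phi_hat r i j K (E2 t)) = F2.
  by apply/funext => t; rewrite /phi_hat V0E /F2 mulrA.
pose Ap := hitting K `&` [set E : affine_line R | 0 < g (direction E)].
pose An := hitting K `&` [set E : affine_line R | g (direction E) < 0].
have mgd : measurable_fun setT (fun E => g (direction E)).
  exact: (measurableT_comp (proj1 bg) (@direction_measurable R)).
have mAp : measurable Ap.
  by apply: measurableI => //; apply: measurable_true; exact: measurable_fun_ltr.
have mAn : measurable An.
  by apply: measurableI => //; apply: measurable_true; exact: measurable_fun_ltr.
have ApE (E : affine_line R) : \1_Ap E = \1_(hitting K) E * (0 < g (direction E))%R%:R :> R.
  by rewrite !indicE in_setI mem_setE -natrM mulnb.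
have AnE (E : affine_line R) : \1_An E = \1_(hitting K) E * (g (direction E) < 0)%R%:R :> R.
  by rewrite !indicE in_setI mem_setE -natrM mulnb.
(* As f = c |g|, division by f leaves the sign of g: the weighted estimator takes only the values 0,
   2 r / c and -2 r / c. *)
pose F1 t := 2 * r / c * (\1_Ap (E1 t) - \1_An (E1 t)).
have bAp : bounded_measurable (fun t => \1_Ap (E1 t) : R).
  exact: (bounded_measurable_comp mE1 (bounded_measurable_indic R mAp)).
have bAn : bounded_measurable (fun t => \1_An (E1 t) : R).
  exact: (bounded_measurable_comp mE1 (bounded_measurable_indic R mAn)).
have bF1 : bounded_measurable F1.
  by apply: bounded_measurableM; [exact: bounded_measurable_cst|exact: bounded_measurableB].
have -> : (fun t => phi_hat r i j K (E1 t) / f (direction (E1 t))) = F1.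
  apply/funext => t; rewrite /phi_hat V0E /F1 ApE AnE fE -/(g _).
  set h := \1_(hitting K) _; case: (ltrgt0P (g (direction (E1 t)))) => [gp|gn|->].
  - by rewrite /=; field; rewrite !gt_eqF.
  - by rewrite /=; field; rewrite gt_eqF// lt_eqF.
  - by rewrite /= !(mulr0, mul0r) subr0 mulr0.
rewrite !variance_bounded_measurable// lte_fin.
have pE A : measurable A -> \int[P1]_t \1_A (E1 t) =
    \int[P2]_w (\1_A (E2 w) * f (direction (E2 w))).
  move=> mA; rewrite Rintegral_indic_comp//.
  exact: (weighted_lawE hr hE2 hE1).
have bf : bounded_measurable f.
  rewrite (_ : f = fun L => c * `|g L|); last by apply/funext => L; rewrite fE.
  by apply: bounded_measurableM => //; exact: bounded_measurable_cst.
have bfd := bounded_measurable_comp mdE2 bf.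
have bAp2 := bounded_measurable_comp mE2 (bounded_measurable_indic R mAp).
have bAn2 := bounded_measurable_comp mE2 (bounded_measurable_indic R mAn).
have bgh : bounded_measurable (fun w => g (direction (E2 w)) * \1_(hitting K) (E2 w)).
  exact: bounded_measurableM.
have meanE : \int[P1]_t F1 t = \int[P2]_w F2 w.
  rewrite Rintegral_bmZ ?Rintegral_bmB//; last exact: bounded_measurableB.
  rewrite !pE// -Rintegral_bmB; try exact: bounded_measurableM.
  rewrite Rintegral_bmZ// -[RHS]mulr1 -(mulVf (lt0r_neq0 c0)) mulrACA; congr (_ * _).
  rewrite [RHS]mulrC -Rintegral_bmZ//; apply: eq_Rintegral => w _.
  rewrite ApE AnE fE; case: (ltrgt0P (g (direction (E2 w)))) => [gp|gn|->].
  - by rewrite /=; ring.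
  - by rewrite /=; ring.
  - by rewrite /=; ring.
(* The square is constant where the estimator is nonzero, and passing to the IUR line multiplies by
   f = c |g|; one factor c survives in the denominator. *)
have sq1 : \int[P1]_t (F1 t * F1 t) = 4 * r ^+ 2 / c * A1.
  transitivity (\int[P1]_t ((2 * r / c) ^+ 2 * (\1_Ap (E1 t) + \1_An (E1 t)))).
    apply: eq_Rintegral => t _; rewrite /F1 ApE AnE indicE.
    by case: (_ \in _); case: ltrgt0P => _ /=; ring.
  rewrite Rintegral_bmZ ?Rintegral_bmD//; last exact: bounded_measurableD.
  rewrite !pE// -Rintegral_bmD; try exact: bounded_measurableM.
  have -> : 4 * r ^+ 2 / c * A1 = (2 * r / c) ^+ 2 * (c * A1).
    by field; rewrite gt_eqF.
  congr (_ * _); rewrite /A1 -Rintegral_bmZ; last first.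
    exact: (bounded_measurableM (bounded_measurable_norm bgd) bh).
  apply: eq_Rintegral => w _; rewrite ApE AnE fE.
  by case: (ltrgt0P (g (direction (E2 w)))) => _ /=; ring.
have sq2 : \int[P2]_w (F2 w * F2 w) = 4 * r ^+ 2 * A2.
  rewrite /A2 -Rintegral_bmZ; last first.
    exact: (bounded_measurableM (bounded_measurable_comp mdE2 bg2) bh).
  apply: eq_Rintegral => w _; rewrite /F2 indicE.
  by case: (_ \in _) => /=; ring.
rewrite meanE sq1 sq2 ltrD2r -mulrA ltr_pM2l; last by rewrite mulr_gt0// exprn_gt0.
(* Normalisation of the density identifies 1 / c with the integral m of |g|. *)
suff -> : c^-1 = \int[nu]_L `|g L| by [].
by rewrite -[RHS](mulKf (lt0r_neq0 c0)) cm mulr1.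
Qed.
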